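(* Let $v>1$ be an integer, let $F$ be an absolutely continuous distribution function of a non-negative random variable $X$ with $E(X)<\infty$, let $\bar F=1-F$, and let $X_1,X_2,\dots$ be i.i.d. with distribution function $F$; let $X_{1:n}\le\cdots\le X_{n:n}$ be the order statistics of $X_1,\dots,X_n$. Let $$D=E\big(\max(X_1,\dots,X_v)+\min(X_1,\dots,X_v)\big),\qquad \widehat D=\frac{v}{n^v}\sum_{i=1}^n\big(i^{v-1}+(n-i)^{v-1}\big)X_{i:n},$$ $$\sigma_4^2=v^2\int_0^\infty\!\!\int_0^\infty\big[\min\{F(x),F(z)\}-F(x)F(z)\big]\big(F^{v-1}(x)+\bar F^{v-1}(x)\big)\big(F^{v-1}(z)+\bar F^{v-1}(z)\big)\,dx\,dz,$$ and assume $0<\sigma_4^2<\infty$. Then, as $n\to\infty$, $\sqrt n\,(\widehat D-D)/\sigma_4$ converges in distribution to a standard normal random variable.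
   Context: $F^{v-1}(x)$ and $\bar F^{v-1}(x)$ denote the powers $(F(x))^{v-1}$ and $(1-F(x))^{v-1}$. The double integral defining $\sigma_4^2$ is a Lebesgue integral. *)

(* Defs.v *)
From HB Require Import structures.
From mathcomp Require Import all_boot all_order all_algebra finmap.
From mathcomp Require Import all_classical all_reals all_analysis.

Set Implicit Arguments.
Unset Strict Implicit.
Unset Printing Implicit Defensive.

Import Order.TTheory GRing.Theory Num.Theory.
Import numFieldTopology.Exports numFieldNormedType.Exports.

Local Open Scope classical_set_scope.
Local Open Scope ring_scope.

Definition absolutely_continuous_fun (R : realType) (F : R -> R) : Prop :=
  forall e : R, 0 < e -> exists2 delta : R, 0 < delta &
    forall (m : nat) (a b : 'I_m -> R),
      (forall i, a i <= b i) ->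
      trivIset setT (fun i => `]a i, b i[%classic) ->
      \sum_(i < m) (b i - a i) < delta ->
      \sum_(i < m) `|F (b i) - F (a i)| < e.

Section random_sequences.
Context (d : measure_display) (T : measurableType d) (R : realType).
Variable P : probability T R.

Definition mutually_independent (X : nat -> {RV P >-> R}) : Prop :=
  forall (J : {fset nat}) (A : nat -> set R), (forall i, measurable (A i)) ->
    P (\bigcap_(i in [set` J]) X i @^-1` A i) =
    (\prod_(i <- J) P (X i @^-1` A i))%E.

(* The members of a sequence indexed by nat are numbered from 0, so the [n]
   first random variables, written X_1, ..., X_n on paper, are
   [X 0], ..., [X n.-1]. *)

Definition iid_with_cdf (F : R -> R) (X : nat -> {RV P >-> R}) : Prop :=
  mutually_independent X /\ forall i x, cdf (X i) x = (F x)%:E.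

(* [Y] takes values in plain functions, so that its terms can be arbitrary
   expressions; that they are random variables is part of the definition. *)
Definition cvg_in_distribution (Y : nat -> T -> R)
    (mu : probability (measurableTypeR R) R) : Prop :=
  (forall n, measurable_fun setT (Y n)) /\
  forall t : R, {for t, continuous (fun x : R => mu `]-oo, x]%classic)} ->
    P [set w | Y n w <= t] @[n --> \oo] --> mu `]-oo, t]%classic.

Variable X : nat -> {RV P >-> R}.

(* The rank [i] is counted from 1: this is X_{i:n} for 1 <= i <= n. *)
Definition order_stat (n i : nat) (w : T) : R :=
  nth 0 (sort <=%R [seq X j w | j <- iota 0 n]) i.-1.

(* The default value [X 0 w] is one of the terms as soon as 0 < v. *)
Definition sample_max (v : nat) (w : T) : R :=
  \big[Num.max/X 0%N w]_(j < v) X j w.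

Definition sample_min (v : nat) (w : T) : R :=
  \big[Num.min/X 0%N w]_(j < v) X j w.

Definition Dmaxmin (v : nat) : R :=
  fine 'E_P[fun w => sample_max v w + sample_min v w].

Definition Dhat (v n : nat) (w : T) : R :=
  v%:R / n%:R ^+ v *
  \sum_(1 <= i < n.+1)
     (i%:R ^+ v.-1 + (n - i)%:R ^+ v.-1) * order_stat n i w.

End random_sequences.

Definition sigma4sq (R : realType) (F : R -> R) (v : nat) : \bar R :=
  let mu := @lebesgue_measure R in
  ((v%:R ^+ 2)%:E *
   \int[(mu \x mu)%E]_(p in `[0%R, +oo[%classic `*` `[0%R, +oo[%classic)
     ((Num.min (F p.1) (F p.2) - F p.1 * F p.2)
      * (F p.1 ^+ v.-1 + (1 - F p.1) ^+ v.-1)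
      * (F p.2 ^+ v.-1 + (1 - F p.2) ^+ v.-1))%:E)%E.

Definition sigma4 (R : realType) (F : R -> R) (v : nat) : R :=
  Num.sqrt (fine (sigma4sq F v)).

(* Main.v *)
(* Let J(u) = u^(v-1) + (1-u)^(v-1) and K(u) = u^v - (1-u)^v, so K' = v J.
   Writing every order statistic as the integral over x >= 0 of the indicator of
   {X_{i:n} > x} turns both sides into integrals in x: D = int (1 - K(F)) and
   Dhat = int (1 - K(F_n)) up to O(1/n), where F_n is the empirical distribution
   function. A second order Taylor expansion of K gives
     Dhat - D = (1/n) sum_j I(X_j) + remainder,  I(y) = int v J(F(x)) (F(x) - 1{y <= x}) dx,
   with E|remainder| <= (4 v^2 / n) int (1 - F) because E(F_n - F)^2 = F(1-F)/n.
   By Fubini, I(X_1) has mean 0 and variance sigma_4^2, so the claim reduces to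
   the central limit theorem for the I(X_j), which Lindeberg's method proves for
   C^2 test functions: E f(n^(-1/2) (Y_1 + ... + Y_n)) is the n-th iterate at 0
   of the convolution operator g |-> (x |-> E g(x + n^(-1/2) Y)), the same iterate
   for a Gaussian Y is independent of n, and one step changes by o(1/n) since only
   the first two moments enter up to a truncated third moment.
   The sample is only almost surely nonnegative, so X_j is first replaced by
   max(X_j, 0). *)

Require Import Defs.
From HB Require Import structures.
From mathcomp Require Import all_boot all_order all_algebra finmap.
From mathcomp Require Import all_classical all_reals all_analysis.
From mathcomp Require Import measurable_realfun.
From mathcomp Require Import ring lra.

Set Implicit Arguments.
Unset Strict Implicit.
Unset Printing Implicit Defensive.

Import Order.TTheory GRing.Theory Num.Theory.
Import numFieldTopology.Exports numFieldNormedType.Exports.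

Local Open Scope classical_set_scope.
Local Open Scope ring_scope.

(** Only two moments of the influence function are at hand, which dictates the Taylor class
    [taylor2_bound]: its remainder is measured by min(h^2, |h|^3), whose expectation at scale
    n^(-1/2) is o(1/n) by dominated convergence. The class asks for the Taylor inequality itself
    rather than for derivatives, so that it survives averaging with the same constant and nothing is
    ever differentiated under an integral sign. Since [weightK] is a polynomial, its second-order
    remainder is at most a fixed multiple of (a - b)^2 on all of [0, 1]; the linearization error can
    therefore be bounded pointwise in x and then integrated, with 1 - F as the only dominating
    function. The variance of the influence function is a triple integral over a law and two
    half-lines. Fubini's theorem applies to it because the expected absolute value of the product of
    two kernels is at most three times their covariance, whose double integral is sigma_4^2. *)

Lemma measurable_natr_bool {R : realType} d (T : measurableType d) (b : T -> bool) :
  measurable_fun setT b -> measurable_fun setT (fun x => (b x)%:R : R).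
Proof.
move=> mb; rewrite (_ : (fun _ => _) = (fun x => if b x then 1 else 0)).
  exact: measurable_fun_ifT.
by apply/funext => x; case: (b x).
Qed.

(** * Standard normal distribution *)

Section lebesgue_affine.
Context {R : realType}.
Local Notation mu := (@lebesgue_measure R).
Local Open Scope ereal_scope.

Let affine (a b : R) : measurableTypeR R -> measurableTypeR R :=
  fun x => (a * x + b)%R.

Let measurable_affine a b : measurable_fun setT (affine a b).
Proof. by apply: measurable_funD => //; exact: measurable_funM. Qed.

(** Lebesgue measure is determined by its values on half-open intervals, and its image under the
    affine map, multiplied by |a|, takes the same values there. *)
Lemma ge0_integral_lebesgue_affine (a b : R) (f : R -> \bar R) : a != 0%R ->
  measurable_fun [set: R] f -> (forall x, 0 <= f x) ->
  \int[mu]_x f x = \int[mu]_x (f (a * x + b)%R * `|a|%:E).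
Proof.
move=> a0 mf f0.
have aa : (0 <= `|a|)%R by [].
pose m' : {measure set (measurableTypeR R) -> \bar R} :=
  mscale (NngNum aa) (pushforward mu (affine a b)).
set m := m' (measurable_affine a b).
have mE A : measurable A -> mu A = m A.
  apply: lebesgue_measure_unique => _ [[p q] _ <-].
  change (mu `]p, q] = `|a|%:E * mu (affine a b @^-1` `]p, q])).
  have [a_gt0|a_lt0|a_eq0] := ltgtP a 0%R; last by rewrite a_eq0 eqxx in a0.
  (* The first branch is a < 0: the preimage swaps the end points, hence is closed on the left and
     open on the right, with the same length. *)
  - have -> : affine a b @^-1` `]p, q] = `[(q - b) / a, (p - b) / a[%classic%R.
      apply/seteqP; split=> x; rewrite /affine/= !in_itv/= => /andP[h1 h2].
        by apply/andP; split; [rewrite ler_ndivrMr//; lra|rewrite ltr_ndivlMr//; lra].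
      by move: h1 h2; rewrite ler_ndivrMr// ltr_ndivlMr// => h1 h2; apply/andP; split; lra.
    rewrite !lebesgue_measure_itv/= !lte_fin ltr_nM2r ?invr_lt0// ltrD2r.
    case: ifPn => _; rewrite ?mule0// -!EFinD -EFinM; congr EFin.
    by rewrite ltr0_norm//; field.
  - have -> : affine a b @^-1` `]p, q] = `](p - b) / a, (q - b) / a]%classic%R.
      apply/seteqP; split=> x; rewrite /affine/= !in_itv/= => /andP[h1 h2].
        by apply/andP; split; [rewrite ltr_pdivrMr//; lra|rewrite ler_pdivlMr//; lra].
      by move: h1 h2; rewrite ltr_pdivrMr// ler_pdivlMr// => h1 h2; apply/andP; split; lra.
    rewrite !lebesgue_measure_itv/= !lte_fin ltr_pM2r ?invr_gt0// ltrD2r.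
    case: ifPn => _; rewrite ?mule0// -!EFinD -EFinM; congr EFin.
    by rewrite gtr0_norm//; field.
rewrite (eq_measure_integral m); last by move=> A mA _; exact: mE.
rewrite ge0_integral_mscale//= ge0_integral_pushforward//=.
rewrite preimage_setT muleC ge0_integralZr//=.
exact: (measurableT_comp mf (measurable_affine a b)).
Qed.

End lebesgue_affine.

Section normal_prob_theory.
Context {R : realType}.
Local Notation mu := (@lebesgue_measure R).
Local Open Scope ereal_scope.

(** The Radon-Nikodym derivative of the normal law equals [normal_pdf] almost everywhere, both
    having the same integral over every measurable set. *)
Lemma ge0_integral_normal_prob (m s : R) (f : R -> \bar R) :
  measurable_fun setT f -> (forall x, 0 <= f x) ->
  \int[normal_prob m s]_x f x = \int[mu]_x (f x * (normal_pdf m s x)%:E).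
Proof.
move=> mf f0.
have dom := @normal_prob_dominates R m s.
rewrite -(Radon_Nikodym_SigmaFinite.change_of_variables dom)//.
apply: ae_eq_integral => //.
- apply: emeasurable_funM => //; apply: (measurable_int mu).
  exact: Radon_Nikodym_SigmaFinite.f_integrable.
- apply: emeasurable_funM => //=; apply/measurableT_comp => //=.
  exact: measurable_normal_pdf.
- apply: ae_eqe_mul2l => /=.
  apply: integral_ae_eq => //=.
  + exact: Radon_Nikodym_SigmaFinite.f_integrable.
  + by apply/measurableT_comp =>//; exact: measurable_normal_pdf.
  + by move=> E E01 mE; rewrite -Radon_Nikodym_SigmaFinite.f_integral.
Qed.

Local Notation gamma := (@normal_prob R 0 1).
Local Notation phi := (normal_pdf (0:R) 1).

Lemma normal_pdf01E (z : R) : phi z = ((Num.sqrt (pi *+ 2))^-1 * expR (- (z ^+ 2 / 2)))%R.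
Proof.
rewrite normal_pdfE ?oner_neq0// /normal_peak /normal_fun expr1n mul1r subr0.
by rewrite mulNr.
Qed.

(** Completing the square. For independent standard normal y and z, put u = (a y + b z) / c: the
    joint density of (y, u) is the density of u times the conditional density of y, which is normal
    with mean a u / c and deviation b / c. *)
Lemma normal_pdf01_mul (a b c u y : R) :
  (0 < b -> 0 < c -> c ^+ 2 = a ^+ 2 + b ^+ 2 ->
  phi ((c * u - a * y) / b) * (c / b) * phi y =
  phi u * normal_pdf (a * u / c) (b / c) y)%R.
Proof.
move=> b0 c0 cE; have bn0 : b != 0%R by rewrite gt_eqF.
have cn0 : c != 0%R by rewrite gt_eqF.
rewrite !normal_pdf01E normal_pdfE ?mulf_neq0 ?invr_neq0// /normal_peak /normal_fun.
have -> : (Num.sqrt ((b / c) ^+ 2 * pi *+ 2) = b / c * Num.sqrt (pi *+ 2))%R.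
  by rewrite -mulrnAr sqrtrM ?sqr_ge0// sqrtr_sqr ger0_norm// divr_ge0 ?ltW.
set p := Num.sqrt _; have p0 : p != 0%R.
  by rewrite gt_eqF// sqrtr_gt0 mulrn_wgt0// pi_gt0.
have H : (expR (- (u ^+ 2 / 2)) * expR (- (y - a * u / c) ^+ 2 / ((b / c) ^+ 2 *+ 2)) =
  expR (- (((c * u - a * y) / b) ^+ 2 / 2)) * expR (- (y ^+ 2 / 2)) :> R)%R.
  rewrite -!expRD; congr expR.
  have -> : (((c * u - a * y) / b) ^+ 2 =
    (c ^+ 2 * u ^+ 2 - 2 * a * c * u * y + (c ^+ 2 - b ^+ 2) * y ^+ 2) / b ^+ 2)%R.
    have -> : (c ^+ 2 - b ^+ 2 = a ^+ 2)%R by rewrite cE; ring.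
    by field.
  have -> : ((y - a * u / c) ^+ 2 =
    y ^+ 2 - 2 * a * u * y / c + (c ^+ 2 - b ^+ 2) * u ^+ 2 / c ^+ 2)%R.
    have -> : (c ^+ 2 - b ^+ 2 = a ^+ 2)%R by rewrite cE; ring.
    by field.
  by field; rewrite bn0.
move: H; set e1 := expR _; set e2 := expR _; set e3 := expR _; set e4 := expR _ => H.
rewrite [LHS](_ : _ = c / b * p^-1 * p^-1 * (e3 * e4))%R; last by ring.
by rewrite -H; field; rewrite bn0 cn0 p0.
Qed.

(** After the change of variable z -> u and Tonelli, the inner integral over y is that of a normal
    density by [normal_pdf01_mul], hence 1. *)
Lemma normal_prob_semigroup (a b c x : R) (f : R -> \bar R) :
  (0 < b)%R -> (0 < c)%R -> (c ^+ 2 = a ^+ 2 + b ^+ 2)%R ->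
  measurable_fun setT f -> (forall x, 0 <= f x) ->
  \int[gamma]_y \int[gamma]_z f (x + a * y + b * z)%R =
  \int[gamma]_u f (x + c * u)%R.
Proof.
move=> b0 c0 cE mf f0.
have bn0 : b != 0%R by rewrite gt_eqF.
have cn0 : c != 0%R by rewrite gt_eqF.
have mphi := @measurable_normal_pdf R 0 1.
have mlin p q : measurable_fun setT (fun z : R => (p + q * z)%R).
  by apply: measurable_funD => //; exact: measurable_funM.
have mfl p q : measurable_fun setT (fun z : R => f (p + q * z)%R).
  exact: (measurableT_comp mf (mlin p q)).
pose w y u := (phi ((c * u - a * y) / b) * (c / b))%R.
have w0 y u : (0 <= w y u)%R.
  by rewrite mulr_ge0 ?normal_pdf_ge0// divr_ge0 ?ltW.
have mw : measurable_fun setT (fun p : R * R => (w p.1 p.2)).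
  apply: measurable_funM => //; apply: (measurableT_comp mphi).
  apply: measurable_funM => //; apply: measurable_funB;
    apply: measurable_funM => //.
have inner y : \int[gamma]_z f (x + a * y + b * z)%R =
    \int[mu]_u (f (x + c * u)%R * (w y u)%:E).
  rewrite ge0_integral_normal_prob//.
  (* Substitution z = (c u - a y) / b, for which a y + b z = c u. *)
  rewrite (@ge0_integral_lebesgue_affine R (c / b) (- (a * y / b)))%R; first last.
  - by move=> z; rewrite mule_ge0// lee_fin normal_pdf_ge0.
  - by apply: emeasurable_funM => //; exact/measurable_EFinP.
  - by rewrite mulf_neq0// invr_neq0.
  apply: eq_integral => u _.
  rewrite (_ : x + a * y + b * (c / b * u + - (a * y / b)) = x + c * u)%R; last by field.
  rewrite -muleA -EFinM gtr0_norm ?divr_gt0//; congr (_ * (_ * _)%:E); congr (phi _).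
  by field.
under eq_integral do rewrite inner.
have mint : measurable_fun setT (fun y => \int[mu]_u (f (x + c * u)%R * (w y u)%:E)).
  apply: (measurable_fun_fubini_tonelli_F (m2 := mu)
    (fun p : R * R => f (x + c * p.2)%R * (w p.1 p.2)%:E)) => /=.
    apply: emeasurable_funM; last exact/measurable_EFinP.
    exact: (measurableT_comp (mfl x c) measurable_snd).
  by move=> p; rewrite mule_ge0 ?lee_fin.
rewrite [LHS]ge0_integral_normal_prob//; last first.
  by move=> y; apply: integral_ge0 => u _; rewrite mule_ge0 ?lee_fin.
transitivity (\int[mu]_y \int[mu]_u (f (x + c * u)%R * (w y u * phi y)%:E)).
  apply: eq_integral => y _; rewrite -ge0_integralZr//=.
  - by apply: eq_integral => u _; rewrite -muleA -EFinM.
  - apply: emeasurable_funM; first exact: mfl.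
    apply/measurable_EFinP; apply: measurable_funM => //; apply: (measurableT_comp mphi).
    by apply: measurable_funM => //; apply: measurable_funB => //; apply: measurable_funM.
  - by move=> u _; rewrite mule_ge0 ?lee_fin.
  - by rewrite lee_fin normal_pdf_ge0.
have /= -> := fubini_tonelli (m1 := mu) (m2 := mu)
  (fun p : R * R => f (x + c * p.2)%R * (w p.1 p.2 * phi p.1)%:E); first last.
- by move=> p; rewrite mule_ge0// lee_fin mulr_ge0// normal_pdf_ge0.
- apply: emeasurable_funM; first exact: (measurableT_comp (mfl x c) measurable_snd).
  apply/measurable_EFinP; apply: measurable_funM => //.
  exact: (measurableT_comp mphi measurable_fst).
rewrite ge0_integral_normal_prob//; apply: eq_integral => u _.
have wE y := normal_pdf01_mul u y b0 c0 cE.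
under eq_integral do rewrite /w wE EFinM.
rewrite ge0_integralZl//; last 2 first.
- apply/measurable_EFinP/measurable_funM => //; exact: measurable_normal_pdf.
- by move=> y _; rewrite lee_fin mulr_ge0 ?normal_pdf_ge0.
rewrite ge0_integralZl//; last 3 first.
- by apply/measurable_EFinP; exact: measurable_normal_pdf.
- by move=> y _; rewrite lee_fin normal_pdf_ge0.
- by rewrite lee_fin normal_pdf_ge0.
by rewrite integral_normal_pdf mule1.
Qed.

Lemma ge0_integral_normal_prob_opp (f : R -> \bar R) :
  measurable_fun setT f -> (forall x, 0 <= f x) ->
  \int[gamma]_z f (- z)%R = \int[gamma]_z f z.
Proof.
move=> mf f0.
have mphi := @measurable_normal_pdf R 0 1.
rewrite !ge0_integral_normal_prob//; last exact: (measurableT_comp mf).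
rewrite [RHS](@ge0_integral_lebesgue_affine R (-1) 0)%R; first last.
- by move=> z; rewrite mule_ge0// lee_fin normal_pdf_ge0.
- by apply: emeasurable_funM => //; exact/measurable_EFinP.
- by rewrite oppr_eq0 oner_neq0.
apply: eq_integral => z _; rewrite normrN1 mule1 addr0 mulN1r; congr (_ * _%:E).
by rewrite !normal_pdf01E sqrrN.
Qed.

(** An antiderivative of z phi(z) is -phi, which vanishes at infinity. *)
Lemma normal_pdf01_FTC (t : R) : (0 <= t)%R ->
  \int[mu]_(z in `[t, +oo[) (z * phi z)%:E = (phi t)%:E.
Proof.
move=> t0.
have dphi (z : R) : is_derive z (1:R)%R (fun x => - phi x)%R (z * phi z)%R.
  rewrite (_ : (fun x => - phi x)%R =
    (fun x => - ((Num.sqrt (pi *+ 2))^-1 * expR (- (x ^+ 2 / 2))))%R); last first.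
    by apply/funext => x; rewrite normal_pdf01E.
  rewrite normal_pdf01E; apply: is_derive_eq; rewrite !scaler0 !add0r /GRing.scale/=.
  change (- ((Num.sqrt (pi *+ 2))^-1 * (expR (- (z ^+ 2 / 2)) * - (2^-1 * (z * 1 + z * 1)))) =
    z * ((Num.sqrt (pi *+ 2))^-1 * expR (- (z ^+ 2 / 2))) :> R)%R.
  by move: (expR _) (Num.sqrt _)^-1%R => e s; field.
rewrite (@ge0_continuous_FTC2y _ _ (fun x => - phi x)%R _ 0)%R; first last.
- by move=> z _; rewrite derive1E; apply: derive_val.
- apply: cvg_at_right_filter; apply: cvgN; exact: (@continuous_normal_pdf R 0%R 1%R (oner_neq0 R)).
- by move=> z _; exact: ex_derive.
- rewrite -[X in _ --> X]oppr0; apply: cvgN.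
  rewrite (_ : phi = (fun x => (Num.sqrt (pi *+ 2))^-1 * expR (- (x ^+ 2 / 2)))%R); last first.
    by apply/funext => x; rewrite normal_pdf01E.
  rewrite -[X in _ --> X](mulr0 (Num.sqrt (pi *+ 2))^-1%R); apply: cvgMr.
  apply: (cvg_comp (fun x : R => x ^+ 2 / 2)%R (fun x => expR (- x)%R)); last exact: cvgr_expR.
  by apply: gt0_cvgMly; [rewrite invr_gt0|exact: cvgr_expr2].
- apply: continuous_subspaceT => z; apply: cvgM; first exact: cvg_id.
  exact: (@continuous_normal_pdf R 0%R 1%R (oner_neq0 R)).
- by move=> z tz; rewrite mulr_ge0 ?normal_pdf_ge0// (le_trans t0).
by rewrite -EFinB sub0r opprK.
Qed.

(** On the half-line, write z^2 phi(z) as the integral of z phi(z) over t in [0, z]. Exchanging the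
    integrals leaves the tail integral of z phi(z) from t, which is phi(t); so the half second
    moment is the half mass. *)
Lemma normal_prob_moment2 : \int[gamma]_z (z ^+ 2)%:E = 1.
Proof.
have mphi := @measurable_normal_pdf R 0 1.
have cphi := @continuous_normal_pdf R 0%R 1%R (oner_neq0 R).
rewrite ge0_integral_normal_prob; last 2 first.
- exact/measurable_EFinP/measurable_funX.
- by move=> z; rewrite lee_fin sqr_ge0.
under eq_integral do rewrite -EFinM.
have pE (z : R) : phi (- z)%R = phi z by rewrite !normal_pdf01E sqrrN.
rewrite ge0_symfun_integralT; first last.
- by move=> z /=; rewrite sqrrN pE.
- by move=> z; apply: cvgM; [exact: exprn_continuous|exact: cphi].
- by move=> z; rewrite mulr_ge0 ?sqr_ge0 ?normal_pdf_ge0.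
rewrite -(integral_normal_pdf (0:R) 1) [RHS]ge0_symfun_integralT; first last.
- by move=> z /=; rewrite pE.
- exact: cphi.
- by move=> z; rewrite normal_pdf_ge0.
congr (_ * _); rewrite -!set_itvcy.
(* The integrand z phi(z) on the region 0 <= t <= z, with p = (z, t). *)
pose h (p : R * R) := ((0 <= p.2)%R%:R * ((p.2 <= p.1)%R%:R * (p.1 * phi p.1)))%R.
have h0 p : (0 <= h p)%R.
  rewrite /h; have [p20|] := leP 0%R p.2; last by rewrite mul0r.
  have [p21|] := leP p.2 p.1; last by rewrite mul0r mulr0.
  by rewrite !mul1r mulr_ge0 ?normal_pdf_ge0// (le_trans p20).
have mh : measurable_fun setT h.
  apply: measurable_funM; first by apply: measurable_natr_bool; exact: measurable_fun_ler.
  apply: measurable_funM; first by apply: measurable_natr_bool; exact: measurable_fun_ler.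
  by apply: measurable_funM => //; exact: (measurableT_comp mphi measurable_fst).
transitivity (\int[mu]_z \int[mu]_t (h (z, t))%:E).
  rewrite integral_mkcond; apply: eq_integral => z _; rewrite patchE.
  case: ifPn => [|z0].
    rewrite inE/= in_itv/= andbT => z0.
    transitivity (\int[mu]_t ((\1_`[0%R, z] t)%:E * (z * phi z)%:E)).
      rewrite ge0_integralZr//=; last first.
      - by rewrite lee_fin mulr_ge0 ?normal_pdf_ge0.
      - by apply/measurable_EFinP; exact: measurable_indic.
      rewrite integral_indic//= setIT lebesgue_measure_itv/= lte_fin.
      rewrite oppr0 adde0; case: ltP => [_|z_le0].
        by rewrite -EFinM expr2 mulrA.
      have -> : z = 0%R by apply/le_anti; rewrite z0 z_le0.
      by rewrite expr0n/= !mul0r mul0e.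
    apply: eq_integral => t _; rewrite -EFinM; congr EFin.
    by rewrite /h/= indicE mem_setE in_itv/= mulrA -natrM mulnb.
  apply/esym; apply: integral0_eq => t _; congr EFin; rewrite /h/=.
  have [t0|] := leP 0%R t; last by rewrite mul0r.
  have [tz|] := leP t z; last by rewrite mul0r mulr0.
  by move: z0; rewrite mem_setE in_itv/= andbT => /negP[]; exact: le_trans tz.
have /= -> := fubini_tonelli (m1 := mu) (m2 := mu) (EFin \o h); first last.
- by move=> p; rewrite lee_fin.
- exact/measurable_EFinP.
rewrite [RHS]integral_mkcond; apply: eq_integral => t _; rewrite patchE.
rewrite mem_setE in_itv/= andbT; case: ifPn => t0; last first.
  by apply: integral0_eq => z _; rewrite /h/= (negbTE t0) mul0r.
rewrite -normal_pdf01_FTC// [RHS]integral_mkcond.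
apply: eq_integral => z _; rewrite patchE mem_setE in_itv/= andbT /h/= t0 mul1r.
by case: ifPn => _; rewrite ?mul1r ?mul0r.
Qed.

(** By symmetry the positive and negative parts have the same integral, and it is finite because the
    negative part is at most 1 + z^2. *)
Lemma normal_prob_moment1 : \int[gamma]_z z%:E = 0.
Proof.
rewrite integralE -[X in X - _]ge0_integral_normal_prob_opp; last 2 first.
- exact/measurable_funepos/measurable_EFinP.
- by move=> z; rewrite funepos_ge0.
rewrite (_ : (fun z : R => (EFin^\+) (- z)%R) = EFin^\-); last first.
  by apply/funext => z; rewrite funeposE funenegE EFinN.
rewrite subee// ge0_fin_numE; last by apply: integral_ge0 => z _; rewrite funeneg_ge0.
apply: (@le_lt_trans _ _ (\int[gamma]_z (1 + (z ^+ 2)%:E))).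
  apply: ge0_le_integral => //=.
  - exact/measurable_funeneg/measurable_EFinP.
  - apply: emeasurable_funD => //; exact/measurable_EFinP/measurable_funX.
  - move=> z _; rewrite funenegE -EFinN -[0]/(0%R%:E) -EFin_max -EFinD lee_fin.
    by rewrite ge_max; apply/andP; split; nra.
rewrite ge0_integralD//; last 2 first.
- by move=> z _; rewrite lee_fin sqr_ge0.
- exact/measurable_EFinP/measurable_funX.
by rewrite normal_prob_moment2 integral_cst//= [X in 1 * X]probability_setT mule1 ltry.
Qed.

End normal_prob_theory.

(** * Lindeberg's method *)

Section integrable_real.
Context d (T : measurableType d) (R : realType) (mu : {measure set T -> \bar R}).
Variables (D : set T) (mD : measurable D).
Implicit Types (f g : T -> R) (k : R).

Lemma integrable_funD f g : mu.-integrable D (EFin \o f) ->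
  mu.-integrable D (EFin \o g) -> mu.-integrable D (EFin \o (fun x => f x + g x)).
Proof. by move=> fi gi; exact: (integrableD mD fi gi). Qed.

Lemma integrable_funB f g : mu.-integrable D (EFin \o f) ->
  mu.-integrable D (EFin \o g) -> mu.-integrable D (EFin \o (fun x => f x - g x)).
Proof. by move=> fi gi; exact: (integrableB mD fi gi). Qed.

Lemma integrable_funZl k f : mu.-integrable D (EFin \o f) ->
  mu.-integrable D (EFin \o (fun x => k * f x)).
Proof. by move=> fi; exact: (integrableZl mD k fi). Qed.

Lemma integrable_funZr k f : mu.-integrable D (EFin \o f) ->
  mu.-integrable D (EFin \o (fun x => f x * k)).
Proof. by move=> fi; under eq_fun do rewrite mulrC; exact: integrable_funZl. Qed.

Lemma le_integrable_fun f g : measurable_fun D f ->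
  (forall x, D x -> `|f x| <= g x) -> mu.-integrable D (EFin \o g) ->
  mu.-integrable D (EFin \o f).
Proof.
move=> mf fg; apply: le_integrable => //; first exact/measurable_EFinP.
by move=> x Dx /=; rewrite lee_fin (le_trans (fg x Dx))// ler_norm.
Qed.

Lemma integrable_fun_norm f : mu.-integrable D (EFin \o f) ->
  mu.-integrable D (EFin \o (fun x => `|f x|)).
Proof. by move=> fi; exact: (integrable_norm fi). Qed.

Lemma integrable_Rintegral_EFin f : mu.-integrable D (EFin \o f) ->
  (\int[mu]_(x in D) f x)%:E = (\int[mu]_(x in D) (f x)%:E)%E.
Proof. by move=> intf; rewrite /Rintegral fineK//; exact: integrable_fin_num. Qed.

End integrable_real.

Section probability_integral.
Context d (T : measurableType d) (R : realType) (P : probability T R).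
Implicit Types f g : T -> R.

Lemma integrable_le_cst f (C : R) : measurable_fun setT f ->
  (forall x, `|f x| <= C) -> P.-integrable setT (EFin \o f).
Proof.
move=> mf fC; apply: (@le_integrable _ _ _ P _ measurableT _ (EFin \o cst C)).
- exact/measurable_EFinP.
- by move=> x _ /=; rewrite lee_fin (le_trans (fC x))// ler_norm.
- exact: finite_measure_integrable_cst.
Qed.

Lemma Rintegral_prob_cst (C : R) : \int[P]_x C = C.
Proof. by rewrite Rintegral_cst// [X in fine X]probability_setT/= mulr1. Qed.

Lemma normr_Rintegral_le f (C : R) : measurable_fun setT f ->
  (forall x, `|f x| <= C) -> `|\int[P]_x f x| <= C.
Proof.
move=> mf fC; have intf := integrable_le_cst mf fC.
rewrite (le_trans (le_normr_Rintegral _ intf))// -[leRHS]Rintegral_prob_cst.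
apply: le_Rintegral => //; last exact: finite_measure_integrable_cst.
by apply: (@integrable_le_cst _ C) => [|x]; rewrite ?normr_id//; exact: measurableT_comp.
Qed.

Lemma integrable_of_sqr f :
  measurable_fun setT f -> P.-integrable setT (EFin \o (fun x => f x ^+ 2)) ->
  P.-integrable setT (EFin \o f).
Proof.
move=> mf f2; have i0 : P.-integrable setT (EFin \o cst (1 : R)).
  exact: finite_measure_integrable_cst.
apply: (le_integrable_fun _ mf _ (integrable_funD measurableT i0 f2)) => // x _.
by rewrite /=; case: (ler0P (f x)); nra.
Qed.

End probability_integral.

Section smear.
Context {R : realType}.
Implicit Types (mu nu : probability (measurableTypeR R) R) (s C x h : R) (f g : R -> R).

Definition bounded_lipschitz C g :=
  (forall x, `|g x| <= C) /\ (forall x h, `|g (x + h) - g x| <= C * `|h|).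

(** [g1] and [g2] stand for the first two derivatives of [g] but are tied to it only by the last
    inequality. The cubic bound serves small h; the quadratic one keeps the expectation finite when
    only second moments exist. *)
Definition taylor2_bound C g g1 g2 :=
  [/\ bounded_lipschitz C g, bounded_lipschitz C g1, bounded_lipschitz C g2 &
   forall x h, `|g (x + h) - g x - g1 x * h - g2 x * h ^+ 2 / 2| <=
     C * Num.min (h ^+ 2) (`|h| ^+ 3)].

Definition smear mu s g x : R := \int[mu]_y g (x + s * y).

Lemma bounded_lipschitz_ge0 C g : bounded_lipschitz C g -> 0 <= C.
Proof. by case=> /(_ 0) gC _; exact: le_trans gC. Qed.

Lemma bounded_lipschitz_measurable C g : bounded_lipschitz C g -> measurable_fun setT g.
Proof.
move=> gC; have C0 := bounded_lipschitz_ge0 gC; apply: continuous_measurable_fun => x.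
apply/cvgrPdist_le => e e0; near=> y.
rewrite distrC -[in g y](subrKC x y) (le_trans (gC.2 _ _))//.
(* C + 1 is positive even when C = 0, so it may be divided by. *)
rewrite (@le_trans _ _ ((C + 1) * `|y - x|))//.
  by rewrite ler_wpM2r// lerDl.
rewrite mulrC -ler_pdivlMr; last by rewrite ltr_wpDl.
near: y; exists (e / (C + 1)) => [|z /=]; first by rewrite /= divr_gt0// ltr_wpDl.
by rewrite distrC => /ltW.
Unshelve. all: by end_near. Qed.

Lemma measurable_affine_comp g x s : measurable_fun setT g ->
  measurable_fun setT (fun y : measurableTypeR R => g (x + s * y)).
Proof.
move=> mg; apply: (measurableT_comp mg).
by apply: measurable_funD => //; exact: measurable_funM.
Qed.

Lemma integrable_smear C mu s g x : bounded_lipschitz C g ->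
  mu.-integrable setT (EFin \o (fun y => g (x + s * y))).
Proof.
move=> gC; apply: (@integrable_le_cst _ _ _ mu _ C) => [|y]; last exact: gC.1.
by apply: measurable_affine_comp; exact: bounded_lipschitz_measurable gC.
Qed.

Lemma smear_bounded_lipschitz C mu s g :
  bounded_lipschitz C g -> bounded_lipschitz C (smear mu s g).
Proof.
move=> gC; have mg := bounded_lipschitz_measurable gC; split => [x|x h].
  by apply: normr_Rintegral_le => [|y]; [exact: measurable_affine_comp|exact: gC.1].
rewrite /smear -RintegralB//; [|exact: integrable_smear gC..].
apply: normr_Rintegral_le => [|y].
  by apply: measurable_funB; exact: measurable_affine_comp.
by rewrite addrAC; exact: gC.2.
Qed.

(** Averaging over a probability preserves every bound in the class with the same C, so the smearing
    can be iterated n times at no cost. *)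
Lemma smear_taylor2_bound C mu s g g1 g2 : taylor2_bound C g g1 g2 ->
  taylor2_bound C (smear mu s g) (smear mu s g1) (smear mu s g2).
Proof.
move=> [gC g1C g2C gT]; split; [exact: smear_bounded_lipschitz..|move=> x h].
have mg := bounded_lipschitz_measurable gC.
have mg1 := bounded_lipschitz_measurable g1C.
have mg2 := bounded_lipschitz_measurable g2C.
have ig := integrable_smear mu s (x + h) gC.
have ig' := integrable_smear mu s x gC.
have ig1 := integrable_smear mu s x g1C.
have ig2 := integrable_smear mu s x g2C.
have ig1h := integrable_funZr measurableT h ig1.
have ig2h := integrable_funZr measurableT (h ^+ 2 / 2) ig2.
have iB := integrable_funB measurableT ig ig'.
have iBB := integrable_funB measurableT iB ig1h.
rewrite /smear -mulrA -RintegralZr// -RintegralZr// -!RintegralB//.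
apply: normr_Rintegral_le => [|y].
  by do 3?[apply: measurable_funB]; do ?[apply: measurable_funM => //]; exact: measurable_affine_comp.
by have := gT (x + s * y) h; rewrite -[_ * _ / 2]mulrA [x + s * y + h]addrAC.
Qed.

Definition truncated_moment3 mu s := \int[mu]_y Num.min ((s * y) ^+ 2) (`|s * y| ^+ 3).

Section second_moment.
Variable mu : probability (measurableTypeR R) R.
Hypothesis mu2 : (\int[mu]_y (y ^+ 2)%:E = 1)%E.

Lemma integrable_sqr : mu.-integrable setT (EFin \o (fun y : R => y ^+ 2)).
Proof.
apply/integrableP; split; first exact/measurable_EFinP/measurable_funX.
under eq_integral do rewrite gee0_abs ?lee_fin ?sqr_ge0//.
by rewrite mu2 ltry.
Qed.

Lemma integrable_id_of_sqr : mu.-integrable setT (EFin \o (fun y : R => y)).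
Proof. exact: (@integrable_of_sqr _ _ _ mu id (@measurable_id _ _ _) integrable_sqr). Qed.

Lemma measurable_truncated s :
  measurable_fun setT (fun y : measurableTypeR R => Num.min ((s * y) ^+ 2) (`|s * y| ^+ 3)).
Proof.
apply: measurable_minr; apply: measurable_funX; first exact: measurable_funM.
by apply: measurableT_comp => //; exact: measurable_funM.
Qed.

Lemma integrable_truncated s :
  mu.-integrable setT (EFin \o (fun y : R => Num.min ((s * y) ^+ 2) (`|s * y| ^+ 3))).
Proof.
apply: (@le_integrable_fun _ _ _ mu _ measurableT _ (fun y => s ^+ 2 * y ^+ 2)).
- exact: measurable_truncated.
- by move=> y _; rewrite -exprMn ger0_norm ?ge_min ?lexx// le_min sqr_ge0 exprn_ge0.
- apply: integrable_funZl => //; exact: integrable_sqr.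
Qed.

Hypothesis mu1 : (\int[mu]_y y%:E = 0)%E.

(** Integrate the Taylor inequality at h = s y: the linear term vanishes because the mean is 0, and
    the quadratic one becomes s^2 because the second moment is 1. *)
Lemma smear_taylor C s g g1 g2 x : taylor2_bound C g g1 g2 ->
  `|smear mu s g x - g x - g2 x * s ^+ 2 / 2| <= C * truncated_moment3 mu s.
Proof.
move=> [gC g1C g2C gT].
have C0 := bounded_lipschitz_ge0 gC.
have mg := bounded_lipschitz_measurable gC.
have ig := integrable_smear mu s x gC.
have igx : mu.-integrable setT (EFin \o cst (g x)) by exact: finite_measure_integrable_cst.
have i1 : mu.-integrable setT (EFin \o (fun y => (g1 x * s) * y)).
  exact: (integrable_funZl measurableT _ integrable_id_of_sqr).
have i2 : mu.-integrable setT (EFin \o (fun y => (g2 x * s ^+ 2 / 2) * y ^+ 2)).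
  exact: (integrable_funZl measurableT _ integrable_sqr).
have -> : smear mu s g x - g x - g2 x * s ^+ 2 / 2 =
  \int[mu]_y (g (x + s * y) - g x - (g1 x * s) * y - (g2 x * s ^+ 2 / 2) * y ^+ 2).
  have iB := integrable_funB measurableT ig igx.
  have iBB := integrable_funB measurableT iB i1.
  rewrite RintegralB// RintegralB// RintegralB// Rintegral_prob_cst.
  rewrite RintegralZl//; last exact: integrable_id_of_sqr.
  rewrite RintegralZl//; last exact: integrable_sqr.
  by rewrite /Rintegral mu1 mu2/= mulr0 subr0 mulr1.
have iR : mu.-integrable setT (EFin \o (fun y =>
    g (x + s * y) - g x - (g1 x * s) * y - (g2 x * s ^+ 2 / 2) * y ^+ 2)).
  have iB := integrable_funB measurableT ig igx.
  have iBB := integrable_funB measurableT iB i1.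
  exact: integrable_funB.
rewrite (le_trans (le_normr_Rintegral _ iR))// /truncated_moment3 -RintegralZl//; last first.
  exact: integrable_truncated.
apply: le_Rintegral => //.
- exact: integrable_fun_norm.
- by apply: integrable_funZl => //; exact: integrable_truncated.
- move=> y _; apply: le_trans (gT x (s * y)).
  by rewrite le_eqVlt; apply/orP; left; apply/eqP; congr `|_|; field.
Qed.

(** The factor n goes inside the minimum and gives min(y^2, |y|^3 / sqrt n), which tends to 0
    pointwise and is dominated by y^2. *)
Lemma truncated_moment3_cvg :
  n%:R * truncated_moment3 mu (Num.sqrt n%:R)^-1 @[n --> \oo] --> (0 : R).
Proof.
pose f (n : nat) (y : R) := Num.min (y ^+ 2) (`|y| ^+ 3 * (Num.sqrt n%:R)^-1).
have fE (n : nat) (y : R) : (0 < n)%N ->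
    n%:R * Num.min (((Num.sqrt n%:R)^-1 * y) ^+ 2) (`|(Num.sqrt n%:R)^-1 * y| ^+ 3) = f n y.
  move=> n0; have s0 : 0 < Num.sqrt (n%:R : R) by rewrite sqrtr_gt0 ltr0n.
  have nE : n%:R = Num.sqrt (n%:R : R) ^+ 2 by rewrite sqr_sqrtr.
  rewrite /f minr_pMr ?ler0n// normrM (ger0_norm (ltW _)) ?invr_gt0//.
  move: s0 nE; move: (Num.sqrt _) => t t0 ->.
  by congr Num.min; field; rewrite gt_eqF.
have f0 n y : 0 <= f n y.
  by rewrite le_min sqr_ge0 mulr_ge0 ?exprn_ge0// invr_ge0 sqrtr_ge0.
have mf n : measurable_fun setT (fun y : measurableTypeR R => f n y).
  apply: measurable_minr; first exact: measurable_funX.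
  by apply: measurable_funM => //; apply: measurable_funX; exact: normr_measurable.
have [||_ _] := @dominated_convergence _ _ _ mu setT measurableT
  (fun n y => (f n y)%:E) (cst 0%E) (fun y => (y ^+ 2)%:E)
  (fun n => (measurable_EFinP _ _).2 (mf n)) (measurable_cst _)
  _ integrable_sqr _.
- apply: aeW => y _ /=; apply: cvg_EFin; first exact: nearW.
  apply: (@squeeze_cvgr _ _ _ _ (cst 0) (fun n => `|y| ^+ 3 * (Num.sqrt n%:R)^-1)).
  + by apply: nearW => n; rewrite f0/= /f ge_min lexx orbT.
  + exact: cvg_cst.
  + rewrite -[X in _ --> X](mulr0 (`|y| ^+ 3)); apply: cvgMr.
    rewrite (_ : (fun n => _) = (fun n => Num.sqrt (n%:R : R)^-1)); last first.
      by apply/funext => n; rewrite sqrtrV.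
    rewrite -[X in _ --> X]sqrtr0; apply: continuous_cvg; first exact: sqrt_continuous.
    apply/gtr0_cvgV0; last exact: cvgr_idn.
    by near=> n; rewrite ltr0n; near: n; exact: nbhs_infty_gt.
- by apply: aeW => y n _ /=; rewrite lee_fin ger0_norm// /f ge_min lexx.
rewrite integral0 => h.
suff : \int[mu]_y f n y @[n --> \oo] --> (0 : R).
  apply: cvg_trans; apply: near_eq_cvg; near=> n.
  rewrite /truncated_moment3 -RintegralZl//; last exact: integrable_truncated.
  by apply: eq_Rintegral => y _; rewrite fE//; near: n; exact: nbhs_infty_gt.
exact: (fine_cvg h).
Unshelve. all: by end_near. Qed.

End second_moment.

Lemma smearB C mu s f g x : bounded_lipschitz C f -> bounded_lipschitz C g ->
  smear mu s f x - smear mu s g x = \int[mu]_y (f (x + s * y) - g (x + s * y)).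
Proof. by move=> fC gC; rewrite RintegralB//; [exact: integrable_smear fC|exact: integrable_smear gC]. Qed.

Lemma iter_smear_taylor2_bound C mu s g g1 g2 n : taylor2_bound C g g1 g2 ->
  taylor2_bound C (iter n (smear mu s) g) (iter n (smear mu s) g1) (iter n (smear mu s) g2).
Proof. by elim: n => // n IHn /IHn; exact: smear_taylor2_bound. Qed.

(* Lindeberg's telescoping: exchange the factors of the n-fold smearing one at a
   time. *)
Lemma iter_smear_dist C mu nu s g g1 g2 n x : taylor2_bound C g g1 g2 ->
  (\int[mu]_y (y ^+ 2)%:E = 1)%E -> (\int[mu]_y y%:E = 0)%E ->
  (\int[nu]_y (y ^+ 2)%:E = 1)%E -> (\int[nu]_y y%:E = 0)%E ->
  `|iter n (smear mu s) g x - iter n (smear nu s) g x| <=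
  n%:R * (C * (truncated_moment3 mu s + truncated_moment3 nu s)).
Proof.
move=> gT mu2 mu1 nu2 nu1; elim: n x => [x|n IHn x].
  by rewrite subrr normr0 mul0r.
have [vC v1C v2C _] := iter_smear_taylor2_bound nu s n gT.
have [uC _ _ _] := iter_smear_taylor2_bound mu s n gT.
rewrite !iterS; set u := iter n _ g; set v := iter n _ g.
(* The first difference applies the same averaging to two iterates, and so inherits the induction
   bound; the second compares one step under [mu] and under [nu] of the same function. *)
rewrite (_ : _ - _ = (smear mu s u x - smear mu s v x) + (smear mu s v x - smear nu s v x)); last by ring.
rewrite (le_trans (ler_normD _ _))// -natr1 mulrDl mul1r lerD//.
  rewrite (smearB _ _ _ uC vC); apply: normr_Rintegral_le => [|y]; last exact: IHn.
  apply: measurable_funB; apply: measurable_affine_comp.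
    exact: bounded_lipschitz_measurable uC.
  exact: bounded_lipschitz_measurable vC.
have vT := iter_smear_taylor2_bound nu s n gT.
have h1 := smear_taylor mu2 mu1 s x vT; have h2 := smear_taylor nu2 nu1 s x vT.
(* Both laws have the same first two moments, so the second-order expansions of the two steps
   coincide and cancel. *)
rewrite mulrDr (_ : _ - _ = (smear mu s v x - v x - iter n (smear nu s) g2 x * s ^+ 2 / 2) -
  (smear nu s v x - v x - iter n (smear nu s) g2 x * s ^+ 2 / 2)); last by ring.
by rewrite (le_trans (ler_normB _ _))// lerD.
Qed.

End smear.

Section smear_normal.
Context {R : realType}.
Local Notation gamma := (@normal_prob R 0 1).
Implicit Types (C s t x : R) (g : R -> R).

(** Nonnegativity of [g] lets the Tonelli form [normal_prob_semigroup] be used; boundedness turns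
    its extended-real integrals into real ones. *)
Lemma smear_normal_semigroup C s t c g x : bounded_lipschitz C g -> (forall x, 0 <= g x) ->
  0 < t -> 0 < c -> c ^+ 2 = s ^+ 2 + t ^+ 2 ->
  smear gamma s (smear gamma t g) x = smear gamma c g x.
Proof.
move=> gC g0 t0 c0 cE; have mg := bounded_lipschitz_measurable gC.
have sgC := smear_bounded_lipschitz gamma t gC.
apply: EFin_inj; rewrite [LHS]integrable_Rintegral_EFin//; last exact: integrable_smear sgC.
rewrite [RHS]integrable_Rintegral_EFin//; last exact: integrable_smear gC.
have /= <- := @normal_prob_semigroup _ s t c x (EFin \o g) t0 c0 cE
  ((measurable_EFinP _ _).2 mg) _; last first.
  by move=> y; rewrite lee_fin.
apply: eq_integral => y _; rewrite [LHS]integrable_Rintegral_EFin//.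
exact: integrable_smear gC.
Qed.

(** Variances add. The count starts at one step because the semigroup identity wants positive
    scales. *)
Lemma iter_smear_normal C s g n x : bounded_lipschitz C g -> (forall x, 0 <= g x) ->
  0 < s -> iter n.+1 (smear gamma s) g x = smear gamma (Num.sqrt n.+1%:R * s) g x.
Proof.
move=> gC g0 s0; elim: n x => [x|n IHn x]; first by rewrite sqrtr1 mul1r.
have sq k : 0 < Num.sqrt (k.+1%:R : R) * s by rewrite mulr_gt0// sqrtr_gt0 ltr0n.
rewrite iterS (_ : iter n.+1 _ g = smear gamma (Num.sqrt n.+1%:R * s) g); last first.
  by apply/funext => y; exact: IHn.
apply: (smear_normal_semigroup _ gC) => //.
by rewrite !exprMn !sqr_sqrtr ?ler0n// -[n.+2]addn1 natrD; ring.
Qed.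

Lemma iter_smear_cvg C (mu : probability (measurableTypeR R) R) g g1 g2 x :
  taylor2_bound C g g1 g2 -> (forall x, 0 <= g x) ->
  (\int[mu]_y (y ^+ 2)%:E = 1)%E -> (\int[mu]_y y%:E = 0)%E ->
  iter n (smear mu (Num.sqrt n%:R)^-1) g x @[n --> \oo] --> smear gamma 1 g x.
Proof.
move=> gT g0 mu2 mu1; have [gC _ _ _] := gT.
apply/subr_cvg0/norm_cvg0P.
apply: (@squeeze_cvgr _ _ _ _ (cst 0) (fun n => C * (n%:R * truncated_moment3 mu (Num.sqrt n%:R)^-1 +
    n%:R * truncated_moment3 gamma (Num.sqrt n%:R)^-1))); last 2 first.
- exact: cvg_cst.
- rewrite -[X in _ --> X](mulr0 C) -[in X in _ --> X](addr0 0); apply: cvgMr; apply: cvgD.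
    exact: truncated_moment3_cvg.
  apply: truncated_moment3_cvg; exact: normal_prob_moment2.
near=> n; rewrite normr_ge0/=.
have n0 : (0 < n)%N by near: n; exact: nbhs_infty_gt.
have s0 : 0 < Num.sqrt (n%:R : R) by rewrite sqrtr_gt0 ltr0n.
have <- : iter n (smear gamma (Num.sqrt n%:R)^-1) g x = smear gamma 1 g x.
  rewrite -(prednK n0) (iter_smear_normal _ _ gC)// ?invr_gt0 prednK//.
  by rewrite divff// gt_eqF.
rewrite -mulrDr mulrCA; apply: iter_smear_dist gT _ _ _ _ => //.
  exact: normal_prob_moment2.
exact: normal_prob_moment1.
Unshelve. all: by end_near. Qed.

End smear_normal.

(** * Smooth test functions *)

Section smooth_step.
Context {R : realType}.
Implicit Types (x h t e C : R).

(** The truncated cube [p0] with its first and second derivatives [p1] and [p2]. *)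
Let p2 x : R := Num.max x 0.
Let p1 x : R := p2 x ^+ 2 / 2.
Let p0 x : R := p2 x ^+ 3 / 6.

Let p2_l x : 0 <= x -> p2 x = x. Proof. exact: max_l. Qed.
Let p2_r x : x <= 0 -> p2 x = 0. Proof. exact: max_r. Qed.

Let p2_lip x h : `|p2 (x + h) - p2 x| <= `|h|.
Proof.
by rewrite /p2; case: (leP x 0); case: (leP (x + h) 0); case: (ler0P h) => *;
  rewrite ler_norml; lra.
Qed.

Let p1_taylor x h : `|p1 (x + h) - p1 x - p2 x * h| <= h ^+ 2 / 2.
Proof. by rewrite /p1 /p2; case: (leP x 0); case: (leP (x + h) 0) => *; rewrite ler_norml; nra. Qed.

Let p0_taylor x h : `|p0 (x + h) - p0 x - p1 x * h - p2 x * h ^+ 2 / 2| <= `|h| ^+ 3 / 6.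
Proof.
rewrite /p0 /p1 /p2; have cube (a b : R) : 0 <= a -> a <= b -> a ^+ 3 <= b ^+ 3.
  by move=> a0 ab; rewrite lerXn2r// nnegrE ?(le_trans a0).
case: (leP x 0) => x0; case: (leP (x + h) 0) => xh0.
- by rewrite !expr0n/= !mul0r !subr0 normr0 divr_ge0// exprn_ge0.
- have h0 : 0 <= h by lra.
  have xh1 := ltW xh0.
  rewrite !expr0n/= !mul0r !subr0 !ger0_norm ?divr_ge0 ?exprn_ge0//.
  by rewrite ler_pM2r ?invr_gt0// cube; lra.
- have h0 : h <= 0 by lra.
  rewrite (ler0_norm h0) ler_norml.
  (* In this case the remainder is ((-h - x)^3 - (-h)^3) / 6, with 0 <= -h - x <= -h. *)
  have := @cube (- h - x) (- h) _ _; have := @exprn_ge0 _ 3 (- h - x) _.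
  by move=> /(_ ltac:(lra)) H1 /(_ ltac:(lra) ltac:(lra)) H2; apply/andP; split; nra.
- rewrite (_ : _ - _ = h ^+ 3 / 6); last by field.
  by rewrite normrM normrX [X in _ * X]ger0_norm.
Qed.

(* Third difference of truncated cubes: the cumulative quadratic B-spline, a C^2
   step from 0 to 1 on [0, 3]. *)
Let third_difference (p : R -> R) x := p x - 3 * p (x - 1) + 3 * p (x - 2) - p (x - 3).
Let S0 := third_difference p0.
Let S1 := third_difference p1.
Let S2 := third_difference p2.

Let S0_le0 x : x <= 0 -> S0 x = 0.
Proof.
move=> x0; rewrite /S0 /third_difference /p0 /p2 !max_r; lra.
Qed.

Let S0_ge3 x : 3 <= x -> S0 x = 1.
Proof. by move=> x0; rewrite /S0 /third_difference /p0 /p2 !max_l; try lra; field. Qed.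

Let S0_ge0_le1 x : 0 <= S0 x <= 1.
Proof.
have [/S0_le0 ->|x0] := leP x 0; first by rewrite lexx ler01.
have [/S0_ge3 ->|x3] := leP 3 x; first by rewrite lexx ler01.
rewrite /S0 /third_difference /p0 (@p2_l x) ?(@p2_r (x - 3)); try lra.
have [x1|x1] := leP x 1.
  have -> : p2 (x - 1) = 0 by apply: p2_r; lra.
  have -> : p2 (x - 2) = 0 by apply: p2_r; lra.
  have h1 := exprn_ge0 3 (ltW x0).
  have h2 : x ^+ 3 <= 1 by rewrite exprn_ile1// ltW.
  by rewrite expr0n/=; apply/andP; split; lra.
have -> : p2 (x - 1) = x - 1 by apply: p2_l; lra.
have [x2|x2] := leP x 2.
  have -> : p2 (x - 2) = 0 by apply: p2_r; lra.
  (* On the middle piece, expanding in u, which lies in [0, 1], reduces the bounds to u^3 <= u^2 <=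
     u. *)
  pose u := x - 1; have -> : x = 1 + u by rewrite /u; lra.
  have [u0 u1] : 0 <= u /\ u <= 1 by rewrite /u; split; lra.
  rewrite [1 + u - 1]addrAC subrr add0r expr0n/=.
  have h3 : 0 <= u ^+ 3 by rewrite exprn_ge0.
  have h1 : u ^+ 3 <= u ^+ 2 by rewrite exprS; have := sqr_ge0 u; nra.
  have h2 : u ^+ 2 <= u by rewrite expr2; nra.
  by apply/andP; split; nra.
have -> : p2 (x - 2) = x - 2 by apply: p2_l; lra.
(* On [2, 3] the spline equals 1 - (3 - x)^3 / 6. *)
have h1 : 0 <= (3 - x) ^+ 3 by rewrite exprn_ge0//; lra.
have h2 : (3 - x) ^+ 3 <= 1 by rewrite exprn_ile1//; lra.
by rewrite expr0n/=; apply/andP; split; nra.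
Qed.

(** A third difference is a combination of three consecutive first differences with coefficients 1,
    -2, 1; those of [p2] are at most 1 in absolute value. *)
Let S2_le x : `|S2 x| <= 4.
Proof.
have := p2_lip x (-1); have := p2_lip (x - 1) (-1); have := p2_lip (x - 2) (-1).
have -> : x - 1 - 1 = x - 2 by ring.
have -> : x - 2 - 1 = x - 3 by ring.
rewrite /S2 /third_difference normrN1 !ler_norml => /andP[? ?] /andP[? ?] /andP[? ?].
by apply/andP; split; lra.
Qed.

Let S1_le x : `|S1 x| <= 1.
Proof.
rewrite /S1 /third_difference /p1 ler_norml.
have [x0|x0] := leP x 0.
  by rewrite !p2_r ?expr0n/=; lra.
have -> : p2 x = x by apply: p2_l; lra.
have [x1|x1] := leP x 1.
  have -> : p2 (x - 1) = 0 by apply: p2_r; lra.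
  have -> : p2 (x - 2) = 0 by apply: p2_r; lra.
  have -> : p2 (x - 3) = 0 by apply: p2_r; lra.
  by rewrite expr0n/=; apply/andP; split; nra.
have -> : p2 (x - 1) = x - 1 by apply: p2_l; lra.
have [x2|x2] := leP x 2.
  have -> : p2 (x - 2) = 0 by apply: p2_r; lra.
  have -> : p2 (x - 3) = 0 by apply: p2_r; lra.
  by rewrite expr0n/=; apply/andP; split; nra.
have -> : p2 (x - 2) = x - 2 by apply: p2_l; lra.
have [x3|x3] := leP x 3.
  have -> : p2 (x - 3) = 0 by apply: p2_r; lra.
  by rewrite expr0n/=; apply/andP; split; nra.
have -> : p2 (x - 3) = x - 3 by apply: p2_l; lra.
by apply/andP; split; nra.
Qed.

(** The coefficients 1, 3, 3, 1 add up to 8; this multiplies the constants 1, 1/2 and 1/6 of the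
    truncated powers here and in the next two estimates. *)
Let S2_lip x h : `|S2 (x + h) - S2 x| <= 8 * `|h|.
Proof.
have := p2_lip (x - 3) h; have := p2_lip (x - 2) h; have := p2_lip (x - 1) h; have := p2_lip x h.
rewrite /S2 /third_difference ![x + h - _]addrAC !ler_norml.
move=> /andP[? ?] /andP[? ?] /andP[? ?] /andP[? ?].
by apply/andP; split; lra.
Qed.

Let S1_taylor x h : `|S1 (x + h) - S1 x - S2 x * h| <= 4 * h ^+ 2.
Proof.
have := p1_taylor (x - 3) h; have := p1_taylor (x - 2) h; have := p1_taylor (x - 1) h;
have := p1_taylor x h.
rewrite /S1 /S2 /third_difference ![x + h - _]addrAC !ler_norml.
move=> /andP[? ?] /andP[? ?] /andP[? ?] /andP[? ?].
by apply/andP; split; lra.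
Qed.

Let S0_taylor x h : `|S0 (x + h) - S0 x - S1 x * h - S2 x * h ^+ 2 / 2| <= 8 / 6 * `|h| ^+ 3.
Proof.
have := p0_taylor (x - 3) h; have := p0_taylor (x - 2) h; have := p0_taylor (x - 1) h;
have := p0_taylor x h.
rewrite /S0 /S1 /S2 /third_difference ![x + h - _]addrAC !ler_norml.
move=> /andP[? ?] /andP[? ?] /andP[? ?] /andP[? ?].
by apply/andP; split; lra.
Qed.

(** Where a Taylor estimate has too high a power of h, the argument splits at |h| = 1: below, higher
    powers of |h| are at most lower ones; above, the uniform bounds on [S0], [S1] and [S2] are
    enough. *)
Let S_taylor2_bound : taylor2_bound 8 S0 S1 S2.
Proof.
split; first split.
- by move=> x; have /andP[? ?] := S0_ge0_le1 x; rewrite ger0_norm//; lra.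
- move=> x h; have := S0_taylor x h; have := S1_le x; have := S2_le x.
  have /andP[? ?] := S0_ge0_le1 x; have /andP[? ?] := S0_ge0_le1 (x + h).
  have [h1|h1] := leP `|h| 1; last first.
    by move=> _ _ _; rewrite ler_norml; apply/andP; split; lra.
  move=> s2 s1 s0.
  rewrite (_ : S0 (x + h) - S0 x = (S0 (x + h) - S0 x - S1 x * h - S2 x * h ^+ 2 / 2) +
    (S1 x * h + S2 x * h ^+ 2 / 2)); last by ring.
  rewrite (le_trans (ler_normD _ _))// (@le_trans _ _ (8 / 6 * `|h| + (1 * `|h| + 4 * `|h| / 2)))//; last first.
    by have := normr_ge0 h; lra.
  rewrite lerD//.
    by rewrite (le_trans s0)// ler_wpM2l// ler_iXnr.
  rewrite (le_trans (ler_normD _ _))// lerD//; first by rewrite normrM ler_wpM2r.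
  by rewrite 2!normrM normrX (@ger0_norm _ 2^-1)// ler_wpM2r// ler_pM// ler_iXnr.
- split; first by move=> x; rewrite (le_trans (S1_le x))// ler1n.
  move=> x h; have := S1_taylor x h; have := S1_le x; have := S2_le x; have := S1_le (x + h).
  have [h1|h1] := leP `|h| 1; last first.
    by rewrite !ler_norml => /andP[? ?] _ /andP[? ?] _; apply/andP; split; lra.
  move=> _ s2 _ s1; rewrite (_ : _ - _ = (S1 (x + h) - S1 x - S2 x * h) + S2 x * h); last by ring.
  rewrite (le_trans (ler_normD _ _))// (_ : 8 * `|h| = 4 * `|h| + 4 * `|h|); last by ring.
  rewrite lerD//; last by rewrite normrM ler_wpM2r.
  by rewrite (le_trans s1)// ler_wpM2l// -(real_normK (num_real h)) ler_iXnr.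
- by split; [move=> x; rewrite (le_trans (S2_le x))//; lra|exact: S2_lip].
- move=> x h; rewrite minr_pMr// le_min; apply/andP; split; last first.
    by rewrite (le_trans (S0_taylor x h))// ler_wpM2r ?exprn_ge0//; lra.
  have [h1|h1] := leP `|h| 1.
    rewrite (le_trans (S0_taylor x h))// -(real_normK (num_real h)).
    have : `|h| ^+ 3 <= `|h| ^+ 2 by rewrite ler_wiXn2l.
    by have := sqr_ge0 `|h|; lra.
  have hh : `|h| <= h ^+ 2 by rewrite -(real_normK (num_real h)) ler_eXnr// ltW.
  have h2 : 1 <= h ^+ 2 by rewrite (le_trans (ltW h1)).
  have /andP[? ?] := S0_ge0_le1 x; have /andP[? ?] := S0_ge0_le1 (x + h).
  rewrite (@le_trans _ _ (1 + 1 * `|h| + 4 * h ^+ 2 / 2))//; last by lra.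
  rewrite (le_trans (ler_normB _ _))// lerD//.
    rewrite (le_trans (ler_normB _ _))// lerD//; first by rewrite ler_norml; apply/andP; split; lra.
    by rewrite normrM ler_wpM2r.
  by rewrite 2!normrM (@ger0_norm _ 2^-1)// (@ger0_norm _ (h ^+ 2)) ?sqr_ge0// ler_wpM2r// ler_wpM2r// sqr_ge0.
Qed.

(** By the chain rule each differentiation brings a factor a; the factor 1 + a + a^2 + a^3 dominates
    all the powers that occur, the cube coming from the Taylor remainder and from the Lipschitz
    bound on the second derivative. *)
Let affine_taylor2_bound C g g1 g2 a b : taylor2_bound C g g1 g2 ->
  (forall x, 0 <= g x <= 1) -> 1 <= C -> 0 <= a ->
  taylor2_bound (C * (1 + a + a ^+ 2 + a ^+ 3)) (fun x => 1 - g (a * x + b))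
    (fun x => - (a * g1 (a * x + b))) (fun x => - (a ^+ 2 * g2 (a * x + b))).
Proof.
move=> [[g0 gl] [g10 g1l] [g20 g2l] gT] g01 C1 a0.
have C0 : 0 <= C by lra.
have a2 := sqr_ge0 a; have a3 := exprn_ge0 3 a0.
have k0 (k : R) : k <= 1 + a + a ^+ 2 + a ^+ 3 -> C * k <= C * (1 + a + a ^+ 2 + a ^+ 3).
  exact: ler_wpM2l.
have E x h : a * (x + h) + b = (a * x + b) + a * h by ring.
have nah h : `|a * h| = a * `|h| by rewrite normrM ger0_norm.
have na2 (y : R) : `|a ^+ 2 * y| = a ^+ 2 * `|y| by rewrite normrM ger0_norm.
split; first split.
- move=> x; have /andP[? ?] := g01 (a * x + b); rewrite ger0_norm ?subr_ge0//.
  by rewrite (@le_trans _ _ (C * 1))//; [lra|rewrite k0//; lra].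
- move=> x h; rewrite E (_ : _ - _ = - (g (a * x + b + a * h) - g (a * x + b))); last by ring.
  rewrite normrN (le_trans (gl _ _))// nah mulrA ler_wpM2r// k0//; lra.
- split=> [x|x h]; rewrite ?E.
    by rewrite normrN nah mulrC (le_trans (ler_wpM2r a0 (g10 _)))// k0//; lra.
  rewrite -opprD normrN -mulrBr nah (le_trans (ler_wpM2l a0 (g1l _ _)))// nah.
  by rewrite [leLHS](_ : _ = C * a ^+ 2 * `|h|); [rewrite ler_wpM2r// k0//; lra|ring].
- split=> [x|x h]; rewrite ?E.
    by rewrite normrN na2 mulrC (le_trans (ler_wpM2r a2 (g20 _)))// k0//; lra.
  rewrite -opprD normrN -mulrBr na2 (le_trans (ler_wpM2l a2 (g2l _ _)))// nah.
  by rewrite [leLHS](_ : _ = C * a ^+ 3 * `|h|); [rewrite ler_wpM2r// k0//; lra|ring].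
- move=> x h; rewrite E (_ : _ - _ = - (g (a * x + b + a * h) - g (a * x + b) -
    g1 (a * x + b) * (a * h) - g2 (a * x + b) * (a * h) ^+ 2 / 2)); last by field.
  rewrite normrN (le_trans (gT _ _))// nah [leLHS]minr_pMr// [leRHS]minr_pMr ?mulr_ge0//; last by lra.
  rewrite le_min; apply/andP; split.
    rewrite (@le_trans _ _ (C * a ^+ 2 * h ^+ 2))//; last by rewrite ler_wpM2r ?sqr_ge0// k0//; lra.
    by rewrite ge_min !exprMn !mulrA lexx.
  rewrite (@le_trans _ _ (C * a ^+ 3 * `|h| ^+ 3))//; last by rewrite ler_wpM2r ?exprn_ge0// k0//; lra.
  by rewrite ge_min !exprMn !mulrA lexx orbT.
Qed.

Lemma smooth_step_exists t e : 0 < e ->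
  exists C f f1 f2, [/\ taylor2_bound C f f1 f2, forall x, 0 <= f x <= 1,
    forall x, x <= t -> f x = 1 & forall x, t + e <= x -> f x = 0].
Proof.
(* The map x |-> a x + b sends [t, t + e] onto [0, 3], where [S0] climbs from 0 to 1. *)
move=> e0; pose a := 3 / e; pose b := - (a * t).
have a0 : 0 < a by rewrite divr_gt0.
have abE x : a * x + b = 3 * ((x - t) / e) by rewrite /b /a; field; rewrite gt_eqF.
exists (8 * (1 + a + a ^+ 2 + a ^+ 3)), (fun x => 1 - S0 (a * x + b)),
  (fun x => - (a * S1 (a * x + b))), (fun x => - (a ^+ 2 * S2 (a * x + b))); split.
- by apply: affine_taylor2_bound; rewrite ?ler1n ?ltW//.
- by move=> x; have /andP[? ?] := S0_ge0_le1 (a * x + b); apply/andP; split; lra.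
- move=> x xt; rewrite S0_le0 ?subr0// abE pmulr_rle0// pmulr_lle0 ?invr_gt0//; lra.
- move=> x xt; rewrite S0_ge3 ?subrr// abE ler_peMr// ler_pdivlMr//; lra.
Qed.

End smooth_step.

Section smooth_convergence.
Context d (T : measurableType d) {R : realType} (P : probability T R).

(* Sandwich the indicator of ]-oo, t] between smooth steps on both sides of t. *)
Lemma cvg_cdf_of_smooth (V : nat -> T -> R) (mu : probability (measurableTypeR R) R) (t : R) :
  (forall n, measurable_fun setT (V n)) ->
  (forall C f f1 f2, taylor2_bound C f f1 f2 -> (forall x, 0 <= f x <= 1) ->
    \int[P]_w f (V n w) @[n --> \oo] --> \int[mu]_x f x) ->
  {for t, continuous (fun x : R => mu `]-oo, x]%classic)} ->
  P [set w | V n w <= t] @[n --> \oo] --> mu `]-oo, t]%classic.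
Proof.
move=> mV smooth ct.
pose F x := fine (mu `]-oo, x]%classic).
pose p n := fine (P [set w | V n w <= t]).
have mVt n s : measurable [set w | V n w <= s].
  rewrite (_ : [set w | _] = V n @^-1` `]-oo, s]%classic).
    by rewrite -[X in measurable X]setTI; exact: mV.
  by apply/seteqP; split => w /=; rewrite in_itv.
have FE x : mu `]-oo, x]%classic = (F x)%:E by rewrite fineK ?fin_num_measure.
have pE n : P [set w | V n w <= t] = (p n)%:E by rewrite fineK ?fin_num_measure.
have cF : F x @[x --> t] --> F t.
  by apply: fine_cvg; rewrite -FE; exact: ct.
under eq_fun do rewrite pE; rewrite FE; apply: cvg_EFin; first exact: nearW.
have intf C f f1 f2 n : taylor2_bound C f f1 f2 ->
    P.-integrable setT (EFin \o (fun w => f (V n w))).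
  move=> [fC _ _ _]; apply: (@integrable_le_cst _ _ _ _ _ C) => [|w]; last exact: fC.1.
  exact: (measurableT_comp (bounded_lipschitz_measurable fC) (mV n)).
have intg C f f1 f2 : taylor2_bound C f f1 f2 -> mu.-integrable setT (EFin \o f).
  move=> [fC _ _ _]; apply: (@integrable_le_cst _ _ _ _ _ C) => [|w]; last exact: fC.1.
  exact: bounded_lipschitz_measurable fC.
have indE d' (T' : measurableType d') (Q : probability T' R) (A : set T') : measurable A ->
    fine (Q A) = \int[Q]_w \1_A w.
  by move=> mA; rewrite /Rintegral integral_indic// setIT.
have indI d' (T' : measurableType d') (Q : probability T' R) (A : set T') : measurable A ->
    Q.-integrable setT (EFin \o (\1_A : T' -> R)).
  move=> mA; apply: (@integrable_le_cst _ _ _ _ _ 1) => //.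
  by move=> w; rewrite indicE; case: (_ \in _); rewrite ?normr1 ?normr0.
have upper e : 0 < e -> \forall n \near \oo, p n <= F (t + e) + e.
  move=> e0; have [C [f [f1 [f2 [fT f01 ft fte]]]]] := smooth_step_exists t e0.
  have le1 n : p n <= \int[P]_w f (V n w).
    rewrite /p indE//; apply: le_Rintegral => //; [exact: indI|exact: intf fT|].
    move=> w _; rewrite indicE; have /andP[f0 _] := f01 (V n w).
    by case: (boolP (w \in _)) => [/[!inE]/= /ft ->|].
  have le2 : \int[mu]_x f x <= F (t + e).
    rewrite /F indE//; apply: le_Rintegral => //; [exact: intg fT|exact: indI|].
    move=> x _; rewrite indicE mem_setE in_itv/=; have /andP[_ f1x] := f01 x.
    by have [//|/ltW xt] := leP x (t + e); rewrite fte.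
  near=> n; rewrite (le_trans (le1 n))// -lerBlDr; apply: le_trans le2.
  rewrite lerBlDr; near: n; have /cvgrPdist_le := smooth _ _ _ _ fT f01.
  by move=> /(_ _ e0); apply: filterS => n; rewrite ler_norml => /andP[? ?]; lra.
have lower e : 0 < e -> \forall n \near \oo, F (t - e) - e <= p n.
  move=> e0; have [C [f [f1 [f2 [fT f01 ft fte]]]]] := smooth_step_exists (t - e) e0.
  have le1 n : \int[P]_w f (V n w) <= p n.
    rewrite /p indE//; apply: le_Rintegral => //; [exact: intf fT|exact: indI|].
    move=> w _; rewrite indicE; have /andP[_ f1x] := f01 (V n w).
    have [Vt|Vt] := leP (V n w) t; first by rewrite mem_set.
    by rewrite fte ?ler0n// subrK ltW.
  have le2 : F (t - e) <= \int[mu]_x f x.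
    rewrite /F indE//; apply: le_Rintegral => //; [exact: indI|exact: intg fT|].
    move=> x _; rewrite indicE mem_setE in_itv/=; have /andP[f0 _] := f01 x.
    by have [/ft ->|] := leP x (t - e).
  near=> n; rewrite (le_trans _ (le1 n))// lerBlDr; apply: le_trans le2 _.
  near: n; have /cvgrPdist_le := smooth _ _ _ _ fT f01.
  by move=> /(_ _ e0); apply: filterS => n; rewrite ler_norml => /andP[? ?]; lra.
apply/cvgrPdist_le => e e0.
have e20 : 0 < e / 2 by rewrite divr_gt0.
have /cvgrPdist_le/(_ _ e20) [r /= r0 rF] := cF.
(* Below r, so that F moves by at most e / 2 between t and t +- s; at most e / 2, to absorb the
   error of the smooth approximation. *)
pose s := Num.min (r / 2) (e / 2).
have s0 : 0 < s by rewrite lt_min e20 divr_gt0.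
have sr : s < r by rewrite /s gt_min; apply/orP; left; lra.
have se : s <= e / 2 by rewrite /s ge_min lexx orbT.
have := rF (t + s); rewrite /ball_/= opprD addrA subrr add0r normrN gtr0_norm// => /(_ sr) F1.
have := rF (t - s); rewrite /ball_/= opprB addrCA subrr addr0 gtr0_norm// => /(_ sr) F2.
move: F1 F2; rewrite !ler_norml => /andP[? ?] /andP[? ?].
near=> n; have : p n <= F (t + s) + s by near: n; exact: upper.
have : F (t - s) - s <= p n by near: n; exact: lower.
by rewrite ler_norml => *; apply/andP; split; lra.
Unshelve. all: by end_near. Qed.

End smooth_convergence.

(** * Sums of independent random variables *)

Section rectangles.
Context d d1 d2 (T : measurableType d) (U : measurableType d1) (V : measurableType d2).
Context (R : realType) (P : probability T R).

(** Both sides are finite measures in C, and rectangles form a pi-system that generates the product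
    sigma-algebra. *)
Lemma independent_rectangles (Z : T -> U * V) (E : set T) :
  measurable_fun setT Z -> measurable E ->
  (forall A B, measurable A -> measurable B ->
    P (Z @^-1` (A `*` B) `&` E) = (P (Z @^-1` (A `*` B)) * P E)%E) ->
  forall C, measurable C -> P (Z @^-1` C `&` E) = (P (Z @^-1` C) * P E)%E.
Proof.
move=> mZ mE rect C mC.
pose m1' : {measure set (U * V) -> \bar R} := pushforward (mrestr P mE) Z.
pose m2' : {measure set (U * V) -> \bar R} :=
  mscale (NngNum (fine_ge0 (measure_ge0 P E))) (pushforward P Z).
set m1 := m1' mZ; set m2 := m2' mZ.
have m2E A : m2 A = (P (Z @^-1` A) * P E)%E.
  change (m2 A) with ((fine (P E))%:E * P (Z @^-1` A))%E.
  by rewrite fineK ?fin_num_measure// muleC.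
rewrite -m2E -[LHS]/(m1 C).
pose G : set (set (U * V)) :=
  [set C | exists A, measurable A /\ exists B, measurable B /\ C = A `*` B].
apply: (measure_unique G (fun=> setT)) => //.
- rewrite measurable_prod_measurableType //; congr (<<s _ >>).
  rewrite predeqE; split => [[A mA [B mB <-]]|[A [mA [B [mB ->]]]]].
    by exists A; split => //; exists B.
  by exists A => //; exists B.
- move=> /= _ _ [X1 [mX1 [X2 [mX2 ->]]]] [Y1 [mY1 [Y2 [mY2 ->]]]].
  rewrite -setXI; exists (X1 `&` Y1); split; first exact: measurableI.
  by exists (X2 `&` Y2); split => //; exact: measurableI.
- by move=> _; exists setT; split => //; exists setT; split => //; rewrite setXTT.
- by rewrite bigcup_const//; exists 0%N.
- by move=> _ [A [mA [B [mB ->]]]]; rewrite m2E; exact: rect.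
- move=> _; rewrite (@le_lt_trans _ _ 1%E) ?ltry//.
  change (P (Z @^-1` setT `&` E) <= 1)%E; rewrite preimage_setT setTI.
  exact: probability_le1.
Qed.

End rectangles.

Section real_law.
Context d (T : measurableType d) (R : realType) (P : probability T R).
Implicit Type X : T -> R.

Definition law X (mX : measurable_fun setT X) : probability (measurableTypeR R) R :=
  distribution P (HB.pack (X : T -> measurableTypeR R)
    (@isMeasurableFun.Build _ _ _ (measurableTypeR R) X mX) : {mfun T >-> measurableTypeR R}).

Lemma ge0_integral_law X (mX : measurable_fun setT X) (f : R -> \bar R) :
  measurable_fun setT f -> (forall x, 0 <= f x)%E ->
  (\int[law mX]_x f x = \int[P]_w f (X w))%E.
Proof. by move=> mf f0; rewrite ge0_integral_distribution. Qed.

Lemma integral_law X (mX : measurable_fun setT X) (f : R -> \bar R) :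
  measurable_fun setT f -> P.-integrable setT (fun w => f (X w)) ->
  (\int[law mX]_x f x = \int[P]_w f (X w))%E.
Proof. by move=> mf fi; rewrite integral_distribution. Qed.

End real_law.

Section partial_sums.
Context d (T : measurableType d) (R : realType) (P : probability T R).
Variable Y : nat -> {RV P >-> R}.

Let S k (w : T) := \sum_(j < k) Y j w.

Let measurable_S k : measurable_fun setT (S k).
Proof. by apply: measurable_sum => j; exact: measurable_funP. Qed.

Let measurable_preimage (f : T -> R) A : measurable_fun setT f -> measurable A ->
  measurable (f @^-1` A).
Proof. by move=> mf mA; rewrite -[X in measurable X]setTI; exact: mf. Qed.

Hypothesis indY : mutually_independent Y.

(** Induction on k with J arbitrary: to add Y_k to the sum, the induction hypothesis is used for S_k
    with k adjoined to J, which treats rectangles in (S_k, Y_k); [independent_rectangles] then gives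
    the half-plane-like sets on which S_k + Y_k lies in A. *)
Lemma partial_sum_independent k (J : {fset nat}) (A : set R) (B : nat -> set R) :
  (forall i, i \in J -> (k <= i)%N) -> measurable A -> (forall i, measurable (B i)) ->
  P (S k @^-1` A `&` \bigcap_(i in [set` J]) Y i @^-1` B i) =
  (P (S k @^-1` A) * \prod_(i <- J) P (Y i @^-1` B i))%E.
Proof.
have mE (J' : {fset nat}) (B' : nat -> set R) : (forall i, measurable (B' i)) ->
    measurable (\bigcap_(i in [set` J']) Y i @^-1` B' i).
  move=> mB'; apply: fin_bigcap_measurable => // i _.
  by apply: measurable_preimage; [exact: measurable_funP|exact: mB'].
elim: k J A B => [|k IHk] J A B kJ mA mB.
  have S0 w : S 0 w = 0 by rewrite /S big_ord0.
  have [A0|A0] := pselect (A 0).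
    rewrite (_ : S 0 @^-1` A = setT); last by apply/seteqP; split=> // w _ /=; rewrite S0.
    by rewrite setTI probability_setT mul1e indY.
  rewrite (_ : S 0 @^-1` A = set0); last by apply/seteqP; split=> // w /=; rewrite S0.
  by rewrite set0I measure0 mul0e.
have kNJ : k \notin J by apply/negP => /kJ; rewrite ltnn.
rewrite -indY//; set E := \bigcap_(_ in _) _.
pose Z (w : T) := (S k w, Y k w).
have mZ : measurable_fun setT Z by apply: measurable_fun_pair => //; exact: measurable_funP.
pose C : set (R * R) := (fun p : R * R => p.1 + p.2) @^-1` A.
have mC : measurable C.
  rewrite -[X in measurable X]setTI; apply: (measurable_funD measurable_fst measurable_snd) => //.
have SZ : S k.+1 @^-1` A = Z @^-1` C.
  by apply/seteqP; split => w; rewrite /C /Z /S /= big_ord_recr.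
rewrite SZ; apply: independent_rectangles => //; first exact: mE.
have joint (J' : {fset nat}) (B' : nat -> set R) A1 A2 : (forall i, i \in J' -> (k < i)%N) ->
    measurable A1 -> measurable A2 -> (forall i, measurable (B' i)) ->
    P (Z @^-1` (A1 `*` A2) `&` \bigcap_(i in [set` J']) Y i @^-1` B' i) =
    (P (S k @^-1` A1) * (P (Y k @^-1` A2) * \prod_(i <- J') P (Y i @^-1` B' i)))%E.
  move=> kJ' mA1 mA2 mB'; have kNJ' : k \notin J' by apply/negP => /kJ'; rewrite ltnn.
  pose B'' i := if i == k then A2 else B' i.
  have B''k : B'' k = A2 by rewrite /B'' eqxx.
  have B''J i : i \in J' -> B'' i = B' i.
    by rewrite /B''; case: eqVneq => // ->; rewrite (negbTE kNJ').
  have -> : Z @^-1` (A1 `*` A2) `&` \bigcap_(i in [set` J']) Y i @^-1` B' i =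
      S k @^-1` A1 `&` \bigcap_(i in [set` (k |` J')%fset]) Y i @^-1` B'' i.
    apply/seteqP; split => w /=.
      move=> [[h1 h2] h3]; split => // i /=; rewrite in_fset1U => /orP[/eqP ->|iJ].
        by rewrite B''k.
      by rewrite B''J//; exact: h3.
    move=> [h1 h2]; split; first split => //.
      by have := h2 k; rewrite /= in_fset1U eqxx B''k; exact.
    by move=> i /= iJ; rewrite -(B''J _ iJ); apply: h2; rewrite /= in_fset1U iJ orbT.
  rewrite IHk//; last 2 first.
  - by move=> i; rewrite in_fset1U => /orP[/eqP ->//|/kJ'/ltnW].
  - by move=> i; rewrite /B''; case: ifP.
  rewrite big_fsetU1//= B''k; congr (_ * (_ * _))%E.
  by apply: eq_big_seq => i iJ; rewrite B''J.
move=> A1 A2 mA1 mA2; rewrite joint// muleA /E indY//; congr (_ * _)%E.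
(* With no further variables, [joint] gives the probability of the rectangle alone. *)
have := joint fset0 B A1 A2 _ mA1 mA2 mB; rewrite big_seq_fset0 mule1.
rewrite (_ : [set` fset0] = set0)// ?bigcap_set0 ?setIT.
  by move=> ->.
by apply/seteqP; split.
Qed.

Let mY k : measurable_fun setT (Y k). Proof. exact: measurable_funP. Qed.
Let SYlaw k := (law P (measurable_S k) \x law P (mY k))%E.

Let pair_mf k (w : T) : measurableTypeR R * measurableTypeR R := (S k w, Y k w).

Let measurable_pair_mf k : measurable_fun setT (pair_mf k).
Proof. exact: (measurable_fun_pair (measurable_S k) (mY k)). Qed.

(** S_k is independent of Y_k, so the joint law agrees with the product measure on rectangles, which
    characterize the latter. *)
Let joint_law k (C : set (measurableTypeR R * measurableTypeR R)) : measurable C ->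
  SYlaw k C = P (pair_mf k @^-1` C).
Proof.
move=> mC; pose m' : {measure set (measurableTypeR R * measurableTypeR R) -> \bar R} :=
  pushforward P (pair_mf k).
change (SYlaw k C = m' (measurable_pair_mf k) C).
apply: product_measure_unique => // A B mA mB.
have := @partial_sum_independent k [fset k]%fset A (fun=> B).
rewrite big_seq_fset1 => <- //; last by move=> i; rewrite inE => /eqP ->.
congr (P _); apply/seteqP; split => w /=.
  by move=> [h1 h2]; split => // i /=; rewrite inE => /eqP ->.
by move=> [h1 h2]; split => //; apply: h2; rewrite /= inE.
Qed.

(** Integrating out the last summand first, by Fubini for the joint law of (S_k, Y_k), is one
    smearing of g. *)
Lemma integral_partial_sumS C s g k : bounded_lipschitz C g ->
  \int[P]_w g (s * S k.+1 w) = \int[P]_w smear (law P (mY k)) s g (s * S k w).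
Proof.
move=> gC; have mg := bounded_lipschitz_measurable gC.
have sgC := smear_bounded_lipschitz (law P (mY k)) s gC.
pose h (p : R * R) := g (s * p.1 + s * p.2).
have mh : measurable_fun setT h.
  by apply: (measurableT_comp mg); apply: measurable_funD; exact: measurable_funM.
have intS f (V : T -> R) : bounded_lipschitz C f -> measurable_fun setT V ->
    P.-integrable setT (EFin \o (fun w => f (V w))).
  move=> fC mV; apply: (@integrable_le_cst _ _ _ _ _ C) => [|w]; last exact: fC.1.
  exact: (measurableT_comp (bounded_lipschitz_measurable fC) mV).
have msS j : measurable_fun setT (fun w => s * S j w) by exact: measurable_funM.
apply: EFin_inj; rewrite [LHS]integrable_Rintegral_EFin//; last exact: intS.
rewrite [RHS]integrable_Rintegral_EFin//; last exact: intS.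
have inth : (SYlaw k).-integrable setT (EFin \o h).
  apply: measurable_bounded_integrable => //.
    change (SYlaw k setT < +oo)%E.
    by rewrite joint_law// preimage_setT probability_setT ltry.
  exists C; split; first exact: num_real.
  by move=> M CM p _; apply: le_trans (ltW CM); exact: gC.1.
transitivity (\int[SYlaw k]_p (h p)%:E)%E.
  rewrite (eq_measure_integral (pushforward P (pair_mf k))); last first.
    by move=> A mA _; exact: joint_law.
  transitivity (\int[P]_(w in pair_mf k @^-1` setT) ((EFin \o h) \o pair_mf k) w)%E.
    rewrite preimage_setT; apply: eq_integral => w _.
    by rewrite /h /pair_mf /S/= big_ord_recr/= mulrDr.
  apply/esym; apply: integral_pushforward => //.
  - exact/measurable_EFinP.
  - rewrite preimage_setT; apply: (@integrable_le_cst _ _ _ P (h \o pair_mf k) C).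
      by apply: measurableT_comp => //; exact: measurable_pair_mf.
    by move=> w; exact: gC.1.
rewrite -(integral12_prod_meas1 inth) /fubini_F.
have /= <- := @integral_law _ _ _ P _ (measurable_S k)
  (fun x => (smear (law P (mY k)) s g (s * x))%:E).
- apply: eq_integral => x _; rewrite [RHS]integrable_Rintegral_EFin//.
  exact: integrable_smear gC.
- apply/measurable_EFinP; apply: (measurableT_comp (bounded_lipschitz_measurable sgC)).
  exact: measurable_funM.
- exact: intS.
Qed.

Lemma integral_partial_sum (mu : probability (measurableTypeR R) R) C s g n :
  (forall k A, measurable A -> P (Y k @^-1` A) = mu A) -> bounded_lipschitz C g ->
  \int[P]_w g (s * \sum_(j < n) Y j w) = iter n (smear mu s) g 0.
Proof.
move=> Ymu; elim: n g => [|n IHn] g gC.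
  rewrite (_ : (fun w => _) = cst (g 0)) ?Rintegral_prob_cst//.
  by apply/funext => w; rewrite big_ord0 mulr0.
(* The last summand is the smearing applied first to g, hence the unfolding of the iterate on the
   inside. *)
rewrite (integral_partial_sumS s n gC) iterSr.
have smE : smear (law P (mY n)) s g = smear mu s g.
  by apply/funext => x; congr fine; apply: eq_measure_integral => A mA _; exact: Ymu.
by rewrite smE; apply: IHn; exact: smear_bounded_lipschitz.
Qed.

End partial_sums.

(** * L-statistics *)

Section weight_function.
Context {R : realType}.
Implicit Types (a b u : R) (v n : nat).

(* [v * weightJ v] is the derivative of [weightK v], and E(max + min) is the
   integral of [1 - weightK v (F x)] over the half-line. *)
Definition weightJ v u : R := u ^+ v.-1 + (1 - u) ^+ v.-1.

Definition weightK v u : R := u ^+ v - (1 - u) ^+ v.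

Lemma exprn_taylor v a b : 0 <= a <= 1 -> 0 <= b <= 1 ->
  `|a ^+ v - b ^+ v - v%:R * b ^+ v.-1 * (a - b)| <= v%:R ^+ 2 * (a - b) ^+ 2.
Proof.
move=> /andP[a0 a1] /andP[b0 b1]; elim: v => [|v IHv].
  by rewrite !expr0 subrr !mul0r subr0 normr0 expr0n/= mul0r.
(* The remainder r_v satisfies r_(v+1) = a r_v + v b^(v-1) (a - b)^2, and v^2 + v <= (v + 1)^2. *)
have -> : a ^+ v.+1 - b ^+ v.+1 - v.+1%:R * b ^+ v.+1.-1 * (a - b) =
    a * (a ^+ v - b ^+ v - v%:R * b ^+ v.-1 * (a - b)) + v%:R * b ^+ v.-1 * (a - b) ^+ 2.
  case: v {IHv} => [|v]; first by rewrite !expr0/=; ring.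
  have -> : v.+2%:R = v.+1%:R + 1 :> R by rewrite natr1.
  by rewrite /= !exprS; ring.
rewrite (le_trans (ler_normD _ _))//.
rewrite (@le_trans _ _ (v%:R ^+ 2 * (a - b) ^+ 2 + v%:R * (a - b) ^+ 2))//.
  rewrite lerD//.
    by rewrite normrM (ger0_norm a0) (le_trans _ IHv)// ler_piMl.
  rewrite normrM [X in _ * X]ger0_norm ?sqr_ge0// ler_wpM2r ?sqr_ge0//.
  by rewrite ger0_norm ?mulr_ge0 ?exprn_ge0// ler_piMr// exprn_ile1.
rewrite -mulrDl ler_wpM2r ?sqr_ge0// -natr1; have := ler0n R v; nra.
Qed.

Lemma weightK_taylor v a b : 0 <= a <= 1 -> 0 <= b <= 1 ->
  `|weightK v a - weightK v b - v%:R * weightJ v b * (a - b)| <= 2 * v%:R ^+ 2 * (a - b) ^+ 2.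
Proof.
move=> ab bb; have h1 := exprn_taylor v ab bb.
have h2 : `|(1 - a) ^+ v - (1 - b) ^+ v - v%:R * (1 - b) ^+ v.-1 * ((1 - a) - (1 - b))| <=
    v%:R ^+ 2 * ((1 - a) - (1 - b)) ^+ 2.
  by apply: exprn_taylor; rewrite subr_ge0 gerBl andbC.
rewrite (_ : (1 - a) - (1 - b) = - (a - b)) in h2; last by ring.
rewrite sqrrN in h2.
rewrite (_ : _ - _ = (a ^+ v - b ^+ v - v%:R * b ^+ v.-1 * (a - b)) -
  ((1 - a) ^+ v - (1 - b) ^+ v - v%:R * (1 - b) ^+ v.-1 * (- (a - b)))); last first.
  by rewrite /weightK /weightJ; ring.
rewrite (le_trans (ler_normB _ _))//.
by rewrite [leRHS](_ : _ = v%:R ^+ 2 * (a - b) ^+ 2 + v%:R ^+ 2 * (a - b) ^+ 2); [exact: lerD|ring].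
Qed.

(** The coefficient of the order statistic of rank i in [Dhat]. *)
Definition weightD v n i : R := v%:R / n%:R ^+ v * (i%:R ^+ v.-1 + (n - i)%:R ^+ v.-1).

Lemma weightDE v n i : (0 < v)%N -> (0 < n)%N -> (i <= n)%N ->
  weightD v n i = v%:R / n%:R * weightJ v (i%:R / n%:R).
Proof.
move=> v0 n0 ni; have nn0 : n%:R != 0 :> R by rewrite pnatr_eq0 -lt0n.
rewrite /weightD /weightJ natrB// (_ : 1 - i%:R / n%:R = (n%:R - i%:R) / n%:R); last by field.
have -> : n%:R ^+ v = n%:R * n%:R ^+ v.-1 :> R by rewrite -exprS prednK.
by rewrite !expr_div_n; field; rewrite nn0 expf_neq0.
Qed.

Lemma frac_itv01 n i : (i <= n)%N -> 0 <= (i%:R / n%:R : R) <= 1.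
Proof.
move=> ni; have [->|n0] := posnP n; first by rewrite invr0 mulr0 lexx ler01.
by rewrite divr_ge0//= ler_pdivrMr ?ltr0n// mul1r ler_nat.
Qed.

(** A Riemann sum for the derivative of [weightK] on [k/n, 1]: expanding at the right end of each
    cell costs 2 v^2 / n^2, there are n - k cells, and the increments telescope up to [weightK] at
    1, which is 1. *)
Lemma sum_weightD v n k : (0 < v)%N -> (0 < n)%N -> (k <= n)%N ->
  `|\sum_(k <= i < n) weightD v n i.+1 - (1 - weightK v (k%:R / n%:R))| <=
  2 * v%:R ^+ 2 / n%:R * (1 - k%:R / n%:R).
Proof.
move=> v0 n0 kn; have nn0 : n%:R != 0 :> R by rewrite pnatr_eq0 -lt0n.
have -> : 1 - weightK v (k%:R / n%:R) =
    \sum_(k <= i < n) (weightK v (i.+1%:R / n%:R) - weightK v (i%:R / n%:R)).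
  rewrite telescope_sumr// divff// {2}/weightK subrr expr1n expr0n.
  by rewrite eqn0Ngt v0 subr0.
rewrite -sumrB (le_trans (ler_norm_sum _ _ _))//.
have -> : 2 * v%:R ^+ 2 / n%:R * (1 - k%:R / n%:R) =
    \sum_(k <= i < n) (2 * v%:R ^+ 2 / n%:R ^+ 2 : R).
  rewrite big_const_nat iter_addr_0 -[_ *+ (n - k)]mulr_natr natrB//; field.
  by [].
rewrite big_seq [leRHS]big_seq; apply: ler_sum => i; rewrite mem_index_iota => /andP[ki ni].
have := weightK_taylor v (frac_itv01 (ltnW ni)) (frac_itv01 ni).
rewrite weightDE// (_ : i%:R / n%:R - i.+1%:R / n%:R = - n%:R^-1); last first.
  by rewrite -natr1; field.
rewrite sqrrN exprVn; apply: le_trans; rewrite le_eqVlt; apply/orP; left; apply/eqP.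
by congr `|_|; ring.
Qed.

(** To be used at a fixed x, with k/n the empirical distribution function and [F] the true one:
    Riemann-sum error plus Taylor error. *)
Lemma weight_error v n k F : (0 < v)%N -> (0 < n)%N -> (k <= n)%N -> 0 <= F <= 1 ->
  `|\sum_(k <= i < n) weightD v n i.+1 - (1 - weightK v F) + v%:R * weightJ v F * (k%:R / n%:R - F)| <=
  2 * v%:R ^+ 2 / n%:R * (1 - k%:R / n%:R) + 2 * v%:R ^+ 2 * (k%:R / n%:R - F) ^+ 2.
Proof.
move=> v0 n0 kn F01.
have h1 := sum_weightD v0 n0 kn; have h2 := weightK_taylor v (frac_itv01 kn) F01.
rewrite (_ : _ + _ = (\sum_(k <= i < n) weightD v n i.+1 - (1 - weightK v (k%:R / n%:R))) -
  (weightK v (k%:R / n%:R) - weightK v F - v%:R * weightJ v F * (k%:R / n%:R - F))); last by ring.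
by rewrite (le_trans (ler_normB _ _))// lerD.
Qed.

Lemma weightJ_itv v u : 0 <= u <= 1 -> 0 <= weightJ v u <= 2.
Proof.
move=> /andP[u0 u1]; have u0' : 0 <= 1 - u by rewrite subr_ge0.
have u1' : 1 - u <= 1 by rewrite gerBl.
rewrite addr_ge0 ?exprn_ge0//= (_ : 2 = 1 + 1); last by ring.
by rewrite lerD// exprn_ile1.
Qed.

(** From 1 - u^v <= v (1 - u) and (1 - u)^v <= 1 - u; this makes the integrand of D integrable as
    soon as the tail 1 - F is. *)
Lemma weightK_bound v u : (0 < v)%N -> 0 <= u <= 1 -> 0 <= 1 - weightK v u <= (v%:R + 1) * (1 - u).
Proof.
move=> v0 /andP[u0 u1]; have u0' : 0 <= 1 - u by rewrite subr_ge0.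
have u1' : 1 - u <= 1 by rewrite gerBl.
have h1 : u ^+ v <= 1 by rewrite exprn_ile1.
have h2 : 0 <= (1 - u) ^+ v by rewrite exprn_ge0.
have h3 : (1 - u) ^+ v <= 1 - u by rewrite -{2}(expr1 (1 - u)) ler_wiXn2l.
have h4 : 1 - u ^+ v <= v%:R * (1 - u).
  elim: (v) => [|k IHk]; first by rewrite expr0 subrr mul0r.
  rewrite (_ : 1 - u ^+ k.+1 = (1 - u ^+ k) + u ^+ k * (1 - u)); last by rewrite exprS; ring.
  by rewrite -natr1 mulrDl mul1r lerD// ler_piMl// exprn_ile1.
by rewrite /weightK mulrDl mul1r; apply/andP; split; lra.
Qed.

End weight_function.

(** * Order statistics and counting *)

Section order_statistics.
Context {R : realType}.

(** In the sorted list the entries at most x form an initial segment, whose length is the count. *)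
Lemma nth_sort_le (s : seq R) i x : (i < size s)%N ->
  (nth 0 (sort <=%R s) i <= x) = (i < count (fun y => (y <= x)%R) s)%N.
Proof.
rewrite -(size_sort <=%R) -(count_sort <=%R).
have : sorted <=%R (sort <=%R s) by exact/sort_sorted/le_total.
elim: (sort _ _) i => //= y t IHt i yt.
have st := path_sorted yt.
have /allP yle := order_path_min le_trans yt.
have [yx|xy] := leP y x.
  by case: i => [_|i]; [rewrite /= yx|rewrite ltnS => it; rewrite /= add1n ltnS; exact: IHt].
move=> it; rewrite (_ : count _ t = 0%N) ?add0n ?ltn0.
  apply/negbTE; rewrite -ltNge; case: i it => //= i it.
  by rewrite (lt_le_trans xy)// yle// mem_nth.
apply/eqP; rewrite eqn0Ngt -has_count; apply/hasPn => z /yle yz.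
by rewrite -ltNge (lt_le_trans xy).
Qed.

End order_statistics.

Section order_statistics_random.
Context d (T : measurableType d) (R : realType) (P : probability T R).
Variable X : nat -> {RV P >-> R}.
Implicit Types (n i v : nat) (x : R) (w : T).

Definition sample_count n x w : nat := (\sum_(j < n) (X j w <= x)%R)%N.

Lemma sample_count_le n x w : (sample_count n x w <= n)%N.
Proof.
rewrite -[leqRHS](card_ord n) -sum1_card; apply: leq_sum => j _; exact: leq_b1.
Qed.

Lemma sample_countE n x w : (sample_count n x w)%:R = \sum_(j < n) (X j w <= x)%R%:R :> R.
Proof. by rewrite /sample_count natr_sum. Qed.

Lemma order_stat_le n i x w : (i < n)%N ->
  (order_stat X n i.+1 w <= x) = (i < sample_count n x w)%N.
Proof.
move=> ni; rewrite /order_stat nth_sort_le ?size_map ?size_iota//.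
rewrite count_map -sum1_count /sample_count big_mkcond/=.
rewrite -(big_mkord xpredT (fun j => nat_of_bool (X j w <= x)%R)).
by rewrite /index_iota subn0; congr (_ < _)%N; apply: eq_bigr => j _; case: ifP.
Qed.

Lemma measurable_order_stat n i : measurable_fun setT (order_stat X n i).
Proof.
(* Ranks beyond n read the default 0 of [nth]. *)
have nth_default0 k : (n <= k)%N -> order_stat X n k.+1 = cst 0.
  by move=> nk; apply/funext => w; rewrite /order_stat nth_default// size_sort size_map size_iota.
have base k : measurable_fun setT (order_stat X n k.+1).
  have [kn|/nth_default0 ->//] := ltnP k n.
  move=> mT; apply: (measurability _ (RGenOInfty.measurableE R)) => //.
  move=> /= _ [_ [x ->] <-]; rewrite setTI.
  rewrite (_ : _ @^-1` _ = (fun w => (sample_count n x w)%:R : R) @^-1` `]-oo, k%:R]); last first.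
    apply/seteqP; split => w /=; rewrite !in_itv/= ?andbT ltNge order_stat_le// -leqNgt ler_nat.
      by [].
    by [].
  rewrite -[X in measurable X]setTI.
  suff : measurable_fun setT (fun w => (sample_count n x w)%:R : R) by exact.
  under eq_fun do rewrite sample_countE; apply: measurable_sum => j.
  apply: measurable_natr_bool; apply: measurable_fun_ler => //; exact: measurable_funP.
(* Rank 0 reads the same position as rank 1, because of the predecessor in [order_stat]. *)
by case: i => [|i]; [exact: (base 0%N)|exact: base].
Qed.

Lemma measurable_Dhat v n : measurable_fun setT (Dhat X v n).
Proof.
apply: measurable_funM => //; apply: measurable_sum => i; apply: measurable_funM => //.
exact: measurable_order_stat.
Qed.

Lemma order_stat_ge0 n i w : (forall j w, 0 <= X j w) -> 0 <= order_stat X n i w.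
Proof.
move=> X0; rewrite /order_stat; set s := sort _ _; have [si|si] := ltnP i.-1 (size s).
  have : nth 0 s i.-1 \in s by exact: mem_nth.
  by rewrite mem_sort => /mapP[j _ ->].
by rewrite nth_default.
Qed.

End order_statistics_random.

(** * Influence function *)

Section product_sigma_finite.
Context d1 d2 (T1 : measurableType d1) (T2 : measurableType d2) (R : realType).
Variables (m1 : {sigma_finite_measure set T1 -> \bar R}).
Variables (m2 : {sigma_finite_measure set T2 -> \bar R}).

Let product_measure_sigma_finite : sigma_finite setT (m1 \x m2)%E.
Proof.
have [F TF Foo] := sigma_finiteT m1; have [G TG Goo] := sigma_finiteT m2.
pose k (n : nat) : nat * nat := odflt (0%N, 0%N) (choice.unpickle n).
exists (fun n => F (k n).1 `*` G (k n).2).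
  apply/seteqP; split => // -[x y] _.
  have : setT x by []. have : setT y by [].
  rewrite {1}TG {1}TF => -[j _ Gy] [i _ Fx].
  by exists (choice.pickle (i, j)) => //; rewrite /k choice.pickleK.
move=> n; have [mFn Fn] := Foo (k n).1; have [mGn Gn] := Goo (k n).2.
split; first exact: measurableX.
by rewrite product_measure1E// lte_mul_pinfty// ge0_fin_numE.
Qed.

(** Makes the product usable as a factor of another product: the variance of the influence function
    needs Fubini for a law times a plane Lebesgue measure. *)
Definition product_sigma_finite : {sigma_finite_measure set (T1 * T2)%type -> \bar R} :=
  HB.pack (m1 \x m2)%E (Measure_isSigmaFinite.Build _ _ _ (m1 \x m2)%E product_measure_sigma_finite).

End product_sigma_finite.

Section influence_function.
Context {R : realType} (nu : probability (measurableTypeR R) R) (F : R -> R) (v : nat).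
Local Notation mu := (@lebesgue_measure R).
Hypothesis nuF : forall x, nu `]-oo, x]%classic = (F x)%:E.

Let ind (x y : R) : R := (y <= x)%R%:R.
Let half (x : R) : R := (0 <= x)%R%:R.

Lemma cdf_itv01 x : 0 <= F x <= 1.
Proof. by rewrite -!lee_fin -nuF measure_ge0 probability_le1. Qed.

Lemma cdf_nondecreasing_fun : {homo F : x y / x <= y}.
Proof.
move=> x y xy; rewrite -lee_fin -!nuF; apply: le_measure; rewrite ?inE//.
by move=> z; rewrite /= !in_itv/= => /le_trans; exact.
Qed.

Lemma cdf_min x y : F (Num.min x y) = Num.min (F x) (F y).
Proof.
have [xy|yx] := leP x y; first by rewrite min_l// cdf_nondecreasing_fun.
by rewrite min_r// cdf_nondecreasing_fun// ltW.
Qed.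

Lemma measurable_cdf : measurable_fun setT F.
Proof. by apply: nondecreasing_measurable => //; exact: cdf_nondecreasing_fun. Qed.

Let measurable_ind (x : R) : measurable_fun setT (ind x : measurableTypeR R -> R).
Proof. by apply: measurable_natr_bool; exact: measurable_fun_ler. Qed.

Let ind01 x y : 0 <= ind x y <= 1.
Proof. by rewrite ler0n lern1 leq_b1. Qed.

Let indM x z y : ind x y * ind z y = ind (Num.min x z) y.
Proof. by rewrite /ind -natrM mulnb le_min. Qed.

Let integrable_ind x : nu.-integrable setT (EFin \o ind x).
Proof.
have ind1 y : `|ind x y| <= 1 by have /andP[? ?] := ind01 x y; rewrite ger0_norm.
exact (@integrable_le_cst _ _ _ nu (ind x) 1 (measurable_ind x) ind1).
Qed.

Let integral_ind x : \int[nu]_y ind x y = F x.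
Proof.
rewrite /Rintegral (_ : (fun y => _) = (fun y : measurableTypeR R => (\1_`]-oo, x] y)%:E)).
  by rewrite integral_indic// setIT; exact: congr1 (nuF x).
by apply/funext => y; rewrite indicE mem_setE in_itv.
Qed.

(** Indicators are idempotent, so every moment in y used below is an integral over the span of 1,
    the two indicators and their product, the latter being the indicator at min(x, z). *)
Let integral_combo x z (p q r s : R) :
  (\int[nu]_y (p + q * ind x y + r * ind z y + s * (ind x y * ind z y))%:E =
   (p + q * F x + r * F z + s * Num.min (F x) (F z))%:E)%E.
Proof.
have i0 : nu.-integrable setT (EFin \o cst p) by exact: finite_measure_integrable_cst.
have i1 := integrable_funZl measurableT q (integrable_ind x).
have i2 := integrable_funZl measurableT r (integrable_ind z).
have i3 := integrable_funZl measurableT s (integrable_ind (Num.min x z)).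
have i01 := integrable_funD measurableT i0 i1.
have i012 := integrable_funD measurableT i01 i2.
have i0123 := integrable_funD measurableT i012 i3.
under eq_integral do rewrite indM.
rewrite -(integrable_Rintegral_EFin measurableT i0123); congr EFin.
rewrite RintegralD// RintegralD// RintegralD// Rintegral_prob_cst !RintegralZl//; do ?exact: integrable_ind.
by rewrite !integral_ind cdf_min.
Qed.

Let integral_comboE x z (p q r s : R) (g : R -> R) :
  (forall y, g y = p + q * ind x y + r * ind z y + s * (ind x y * ind z y)) ->
  (\int[nu]_y (g y)%:E = (p + q * F x + r * F z + s * Num.min (F x) (F z))%:E)%E.
Proof. by move=> gE; under eq_integral do rewrite gE; exact: integral_combo. Qed.

Let c x : R := half x * (v%:R * weightJ v (F x)).

Let c_ge0 x : 0 <= c x.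
Proof. by have /andP[? ?] := weightJ_itv v (cdf_itv01 x); rewrite !mulr_ge0. Qed.

Let c_le x : c x <= 2 * v%:R * half x.
Proof.
have /andP[? ?] := weightJ_itv v (cdf_itv01 x).
by rewrite /c mulrC ler_wpM2r// mulrC ler_wpM2r.
Qed.

Let measurable_half : measurable_fun setT half.
Proof. by apply: measurable_natr_bool; exact: measurable_fun_ler. Qed.

Let measurable_c : measurable_fun setT c.
Proof.
apply: measurable_funM => //; apply: measurable_funM => //.
have mF := measurable_cdf.
by apply: measurable_funD; apply: measurable_funX => //; exact: measurable_funB.
Qed.

(* The linearized L-statistic is the average of [influence] over the sample. *)
Definition influence_kernel (y x : R) : R :=
  (0 <= x)%R%:R * (v%:R * weightJ v (F x)) * (F x - (y <= x)%R%:R).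
Local Notation a := influence_kernel.

Definition influence (y : R) : R := \int[mu]_x a y x.

Let aE y x : a y x = c x * (F x - ind x y). Proof. by []. Qed.

(** The indicator takes only the values 0 and 1, so |F - 1| and |F - 0| interpolate to an expression
    affine in it. *)
Let norm_aE y x : `|a y x| = c x * (F x + (1 - 2 * F x) * ind x y).
Proof.
rewrite aE normrM ger0_norm//; congr (_ * _).
have /andP[? ?] := cdf_itv01 x.
rewrite /ind; case: leP => _ /=; last by rewrite subr0 mulr0 addr0 ger0_norm.
by rewrite ler0_norm; lra.
Qed.

Lemma measurable_influence_kernel : measurable_fun setT (fun p : R * R => a p.1 p.2).
Proof.
apply: measurable_funM.
  exact: (measurableT_comp measurable_c measurable_snd).
apply: measurable_funB; first exact: (measurableT_comp measurable_cdf measurable_snd).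
by apply: measurable_natr_bool; exact: measurable_fun_ler.
Qed.

Let measurable_a1 y : measurable_fun setT (a y).
Proof.
apply: measurable_funM; first exact: measurable_c.
apply: measurable_funB; first exact: measurable_cdf.
by apply: measurable_natr_bool; exact: measurable_fun_ler.
Qed.

Hypothesis tailF : mu.-integrable setT (EFin \o (fun x => (0 <= x)%R%:R * (1 - F x))).

Let integrable_box (y : R) : mu.-integrable setT (EFin \o (fun x : R => half x * (x <= y)%R%:R)).
Proof.
apply/integrableP; split.
  apply/measurable_EFinP/measurable_funM => //.
  by apply: measurable_natr_bool; exact: measurable_fun_ler.
rewrite (_ : (fun x => _) = (fun x => (\1_`[0, y] x)%:E)).
  rewrite integral_indic// setIT [ltLHS]lebesgue_measure_itv/=; case: ifPn => _; rewrite ?ltry//.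
apply/funext => x /=; congr EFin.
by rewrite /half -natrM mulnb normr_nat indicE mem_setE in_itv.
Qed.

(** For x < y the kernel is bounded and lives on [0, y]; from y on it is at most a multiple of 1 -
    F(x). *)
Lemma integrable_influence_kernel y : mu.-integrable setT (EFin \o a y).
Proof.
have := integrable_funZl measurableT (2 * v%:R) (integrable_funD measurableT (integrable_box y) tailF).
apply: le_integrable_fun; [by []|exact: measurable_a1|move=> x _].
rewrite norm_aE -mulrDr mulrA; have /andP[? ?] := cdf_itv01 x.
apply: ler_pM => //.
  by have /andP[? ?] := ind01 x y; nra.
have [yx|xy] := leP y x.
  rewrite (_ : ind x y = 1); last by rewrite /ind yx.
  by have := ler0n R (x <= y)%R; lra.
have e1 : ind x y = 0 by rewrite /ind leNgt xy.
have e2 : (x <= y)%R%:R = 1 :> R by rewrite ltW.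
by rewrite e1 e2; lra.
Qed.

Let integral_norm_a x : (\int[nu]_y `|a y x|%:E = (c x * (2 * F x * (1 - F x)))%:E)%E.
Proof.
rewrite (@integral_comboE x x (c x * F x) (c x * (1 - 2 * F x)) 0 0).
  by congr EFin; ring.
by move=> y; rewrite norm_aE; ring.
Qed.

(** Integrating over y first gives 2 c F (1 - F), with c at most 2 v, hence a bound by 4 v times the
    tail. *)
Lemma integrable_influence_kernel_prod :
  (nu \x mu)%E.-integrable setT (fun p : measurableTypeR R * measurableTypeR R => (a p.1 p.2)%:E).
Proof.
apply/integrable21ltyP; first by apply/measurable_EFinP; exact: measurable_influence_kernel.
rewrite /=; under eq_integral do rewrite integral_norm_a.
have /integrableP[_] := integrable_funZl measurableT (4 * v%:R) tailF.
apply: le_lt_trans; apply: ge0_le_integral => //.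
- move=> x _; have /andP[? ?] := cdf_itv01 x.
  by rewrite lee_fin mulr_ge0// mulr_ge0 ?subr_ge0// mulr_ge0.
- apply/measurable_EFinP; apply: measurable_funM => //.
  have mF := measurable_cdf.
  by apply: measurable_funM; [exact: measurable_funM|exact: measurable_funB].
- apply: measurableT_comp => //; apply/measurable_EFinP; apply: measurable_funM => //.
  by apply: measurable_funM => //; apply: measurable_funB => //; exact: measurable_cdf.
- move=> x _; have /andP[F0 F1] := cdf_itv01 x; rewrite lee_fin.
  rewrite [leRHS]ger0_norm; last by rewrite !mulr_ge0// subr_ge0.
  rewrite (@le_trans _ _ (2 * v%:R * half x * (2 * (1 - F x))))//.
    rewrite ler_pM//; first by rewrite mulr_ge0 ?subr_ge0// mulr_ge0.
    by rewrite ler_wpM2r ?subr_ge0// ler_piMr.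
  by rewrite le_eqVlt; apply/orP; left; apply/eqP; rewrite /half; ring.
Qed.

Lemma measurable_influence : measurable_fun setT influence.
Proof.
have := measurable_fubini_F integrable_influence_kernel_prod.
by move=> /(measurableT_comp (@fine_measurable R setT measurableT)).
Qed.

Let influenceE y : (influence y)%:E = (\int[mu]_x (a y x)%:E)%E.
Proof. by rewrite integrable_Rintegral_EFin//; exact: integrable_influence_kernel. Qed.

Lemma influence_mean : (\int[nu]_y (influence y)%:E = 0)%E.
Proof.
under eq_integral do rewrite influenceE.
have /= -> := Fubini integrable_influence_kernel_prod.
apply: integral0_eq => x _.
rewrite (@integral_comboE x x (c x * F x) (- c x) 0 0).
  by congr EFin; ring.
by move=> y; rewrite aE; ring.
Qed.

(** The covariance of the kernel at x and at z under [nu]. *)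
Let cov x z := c x * c z * (Num.min (F x) (F z) - F x * F z).

Let cov_ge0 x z : 0 <= cov x z.
Proof.
apply: mulr_ge0; first exact: mulr_ge0.
rewrite subr_ge0; have /andP[? ?] := cdf_itv01 x.
have /andP[? ?] := cdf_itv01 z.
by rewrite le_min ler_piMr// ler_piMl.
Qed.

Let measurable_cov : measurable_fun setT (fun q : R * R => cov q.1 q.2).
Proof.
have mF1 := measurableT_comp measurable_cdf (@measurable_fst _ _ R R).
have mF2 := measurableT_comp measurable_cdf (@measurable_snd _ _ R R).
have mc1 := measurableT_comp measurable_c (@measurable_fst _ _ R R).
have mc2 := measurableT_comp measurable_c (@measurable_snd _ _ R R).
apply: measurable_funM; first exact: measurable_funM.
by apply: measurable_funB; [exact: measurable_minr|exact: measurable_funM].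
Qed.

Let sigma4sqE : sigma4sq F v = (\int[(mu \x mu)%E]_q (cov q.1 q.2)%:E)%E.
Proof.
have mF1 := measurableT_comp measurable_cdf (@measurable_fst _ _ R R).
have mF2 := measurableT_comp measurable_cdf (@measurable_snd _ _ R R).
rewrite /sigma4sq -ge0_integralZl//=; last 3 first.
- exact: measurableX.
- apply: measurable_funTS; apply/measurable_EFinP.
  apply: measurable_funM; first apply: measurable_funM.
  + by apply: measurable_funB; [exact: measurable_minr|exact: measurable_funM].
  + by apply: measurable_funD; apply: measurable_funX => //; exact: measurable_funB.
  + by apply: measurable_funD; apply: measurable_funX => //; exact: measurable_funB.
- move=> q _; rewrite lee_fin.
  have /andP[? ?] := cdf_itv01 q.1; have /andP[? ?] := cdf_itv01 q.2.
  have /andP[? ?] := weightJ_itv v (cdf_itv01 q.1).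
  have /andP[? ?] := weightJ_itv v (cdf_itv01 q.2).
  by rewrite !mulr_ge0// subr_ge0 le_min ler_piMr// ler_piMl.
rewrite [LHS]integral_mkcond; apply: eq_integral => q _; rewrite patchE.
rewrite /cov /c /half in_setX !mem_setE !in_itv/= !andbT.
case: (0 <= q.1); case: (0 <= q.2); rewrite /= ?mul0r ?mulr0 ?mul0r// !mul1r -EFinM.
by congr EFin; rewrite /weightJ; ring.
Qed.

Let integral_aa x z : (\int[nu]_y (a y x * a y z)%:E = (cov x z)%:E)%E.
Proof.
rewrite (@integral_comboE x z (c x * c z * F x * F z) (- (c x * c z * F z))
  (- (c x * c z * F x)) (c x * c z)).
  by congr EFin; rewrite /cov; ring.
by move=> y; rewrite !aE; ring.
Qed.

(** This lets finiteness of sigma_4^2 alone yield absolute integrability of the triple integrand.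
    With p <= q the two values of F, three times the covariance exceeds the left side by 2 p (1 - q)
    (1 - q + p), up to the factor c x c z. *)
Let integral_norm_aa x z : (\int[nu]_y `|a y x * a y z|%:E <= (3 * cov x z)%:E)%E.
Proof.
rewrite (@integral_comboE x z (c x * c z * F x * F z) (c x * c z * (1 - 2 * F x) * F z)
  (c x * c z * F x * (1 - 2 * F z)) (c x * c z * (1 - 2 * F x) * (1 - 2 * F z))); last first.
  by move=> y; rewrite normrM !norm_aE; ring.
rewrite lee_fin.
have cc : 0 <= c x * c z by rewrite mulr_ge0.
have /andP[x0 x1] := cdf_itv01 x; have /andP[z0 z1] := cdf_itv01 z.
rewrite /cov [leLHS](_ : _ = c x * c z * (F x * F z + (1 - 2 * F x) * F z * F x +
  F x * (1 - 2 * F z) * F z + (1 - 2 * F x) * (1 - 2 * F z) * Num.min (F x) (F z))); last by ring.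
rewrite [leRHS]mulrCA ler_wpM2l//.
have h (p q : R) : 0 <= p -> p <= 1 -> 0 <= q -> q <= 1 -> p <= q ->
    p * q + (1 - 2 * p) * q * p + p * (1 - 2 * q) * q + (1 - 2 * p) * (1 - 2 * q) * p <= 3 * (p - p * q).
  move=> p0 p1 q0 q1 pq; rewrite -subr_ge0.
  rewrite (_ : _ - _ = 2 * (p * ((1 - q) * (1 - q + p)))); last by ring.
  by rewrite !mulr_ge0//; lra.
have [xz|zx] := leP (F x) (F z); first exact: h.
by have := h _ _ z0 z1 x0 x1 (ltW zx); lra.
Qed.

Let sqr_integral_a y : ((influence y ^+ 2)%:E = \int[(mu \x mu)%E]_q (a y q.1 * a y q.2)%:E)%E.
Proof.
have ia := integrable_influence_kernel y.
have ma : measurable_fun setT (fun q : R * R => a y q.1 * a y q.2).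
  apply: measurable_funM.
    exact: (measurableT_comp (measurable_a1 y) measurable_fst).
  exact: (measurableT_comp (measurable_a1 y) measurable_snd).
have iaa : (mu \x mu)%E.-integrable setT (fun q : R * R => (a y q.1 * a y q.2)%:E).
  apply/integrable12ltyP; first exact/measurable_EFinP.
  have iN := integrable_fun_norm ia.
  have E1 x : (\int[mu]_z `|(a y x * a y z)%:E| = (`|a y x| * \int[mu]_z `|a y z|)%:E)%E.
    rewrite EFinM integrable_Rintegral_EFin// -integralZl//.
    by apply: eq_integral => z _; rewrite -EFinM/= normrM.
  rewrite /=; under eq_integral do rewrite E1.
  have := integrable_funZr measurableT (\int[mu]_z `|a y z|) iN.
  move=> /(integrable_fin_num measurableT); rewrite ge0_fin_numE//.
  by apply: integral_ge0 => x _; rewrite lee_fin mulr_ge0// Rintegral_ge0.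
have /= <- := integral12_prod_meas1 iaa.
have E1 x : (\int[mu]_z (a y x * a y z)%:E = (a y x * influence y)%:E)%E.
  by rewrite EFinM influenceE -integralZl//.
rewrite /fubini_F/=; under eq_integral do rewrite E1.
rewrite -(integrable_Rintegral_EFin measurableT (integrable_funZr measurableT (influence y) ia)).
by rewrite RintegralZr// expr2.
Qed.

(** The squared integral is a double integral in (x, z); exchanging it with the expectation leaves
    the covariance. *)
Lemma influence_variance : (sigma4sq F v < +oo)%E ->
  (\int[nu]_y (influence y ^+ 2)%:E = sigma4sq F v)%E.
Proof.
pose mm := product_sigma_finite mu mu.
rewrite sigma4sqE => fin.
pose f (p : measurableTypeR R * (measurableTypeR R * measurableTypeR R)) : \bar R :=
  (a p.1 p.2.1 * a p.1 p.2.2)%:E.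
have mf : measurable_fun setT f.
  apply/measurable_EFinP; apply: measurable_funM.
    apply: (measurableT_comp measurable_influence_kernel (_ : measurable_fun setT (fun p => (p.1, p.2.1)))).
    apply: measurable_fun_pair => //; exact: (measurableT_comp measurable_fst measurable_snd).
  apply: (measurableT_comp measurable_influence_kernel (_ : measurable_fun setT (fun p => (p.1, p.2.2)))).
  apply: measurable_fun_pair => //; exact: (measurableT_comp measurable_snd measurable_snd).
have intf : (nu \x mm)%E.-integrable setT f.
  apply/integrable21ltyP => //.
  apply: (@le_lt_trans _ _ (3%:E * \int[mm]_q (cov q.1 q.2)%:E)%E); last first.
    by rewrite lte_mul_pinfty.
  rewrite -ge0_integralZl//; last 2 first.
  - exact/measurable_EFinP.
  - by move=> q _; rewrite lee_fin.
  apply: ge0_le_integral => //.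
  - by move=> q _; apply: integral_ge0.
  - apply: (measurable_fun_fubini_tonelli_G (m1 := nu) (abse \o f)) => [|p].
      exact: measurableT_comp.
    exact: abse_ge0.
  - by apply: emeasurable_funM => //; exact/measurable_EFinP.
  - by move=> q _; exact: integral_norm_aa.
under eq_integral do rewrite sqr_integral_a.
have /= -> := Fubini intf.
by apply: eq_integral => q _; exact: integral_aa.
Qed.

End influence_function.

(** * Linearization *)

Section Rintegral_sum.
Context d (T : measurableType d) (R : realType) (mu : {measure set T -> \bar R}).
Variables (I : Type) (f : I -> T -> R).
Hypothesis fi : forall i, mu.-integrable setT (EFin \o f i).

Lemma integrable_fun_sum (s : seq I) :
  mu.-integrable setT (EFin \o (fun x => \sum_(i <- s) f i x)).
Proof.
rewrite (_ : _ \o _ = (fun x => \sum_(i <- s) (EFin \o f i) x)%E).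
  exact: integrable_sum.
by apply/funext => x /=; rewrite sumEFin.
Qed.

Lemma Rintegral_sum (s : seq I) :
  \int[mu]_x (\sum_(i <- s) f i x) = \sum_(i <- s) \int[mu]_x f i x.
Proof.
elim: s => [|i s IHs].
  by under eq_Rintegral do rewrite big_nil; rewrite big_nil Rintegral_cst// mul0r.
rewrite big_cons -IHs -RintegralD//; last exact: integrable_fun_sum.
by under eq_Rintegral do rewrite big_cons.
Qed.

End Rintegral_sum.

Lemma probability_eq_cdf (R : realType) (P Q : probability (measurableTypeR R) R) :
  (forall x, P `]-oo, x]%classic = Q `]-oo, x]%classic) ->
  forall A, measurable A -> P A = Q A.
Proof.
move=> PQ A mA.
have PQo (x : R) : P `]x, +oo[%classic = Q `]x, +oo[%classic.
  by rewrite -setCitvl !probability_setC// PQ.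
apply: (@measure_unique _ R (measurableTypeR R) (@RGenOInfty.G R) (fun n => `]- n%:R, +oo[%classic)) => //.
- exact: RGenOInfty.measurableE.
- move=> _ _ [x ->] [y ->]; exists (Num.max x y).
  by apply/seteqP; split => z /=; rewrite !in_itv/= !andbT gt_max => /andP.
- by move=> n; exists (- n%:R).
- apply/seteqP; split => // x _; exists (Num.bound `|x|) => //=.
  rewrite in_itv/= andbT ltrNl; apply: (le_lt_trans (ler_norm _)); rewrite normrN.
  exact: archi_boundP.
- by move=> _ [x ->]; exact: PQo.
- by move=> n; rewrite (le_lt_trans (probability_le1 _ _))// ltry.
Qed.

Section iid_sample.
Context d (T : measurableType d) (R : realType) (P : probability T R).
Variables (F : R -> R) (X : nat -> {RV P >-> R}).
Hypothesis X_iid : iid_with_cdf F X.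

Let X_ind : mutually_independent X. Proof. by case: X_iid. Qed.

Let X_cdf j x : cdf (X j) x = (F x)%:E. Proof. by case: X_iid. Qed.

Let mX j : measurable_fun setT (X j). Proof. exact: measurable_funP. Qed.

Lemma iid_event_prob n (A : set R) (p : R) : measurable A ->
  (forall j, P (X j @^-1` A) = p%:E) ->
  P [set w | forall j, (j < n)%N -> A (X j w)] = (p ^+ n)%:E.
Proof.
(* The finite set {0, ..., n - 1}, built by iteration so that the product loses one factor per
   induction step. *)
move=> mA Ap; pose J := iteri n (fun k J => (k |` J)%fset) fset0.
have JE k i : (i \in iteri k (fun k J => (k |` J)%fset) fset0) = (i < k)%N.
  elim: k => [|k IHk]; first by rewrite in_fset0 ltn0.
  by rewrite iteriS in_fset1U IHk [RHS]ltnS [RHS]leq_eqVlt.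
rewrite (_ : [set w | _] = \bigcap_(i in [set` J]) X i @^-1` A); last first.
  apply/seteqP; split => w /= h j; first by rewrite /= JE; exact: h.
  by move=> jn; apply: h; rewrite /= JE.
rewrite X_ind//; under eq_bigr do rewrite Ap.
rewrite /J; elim: n {J} => [|n IHn]; first by rewrite /= big_seq_fset0.
rewrite iteriS big_fsetU1/= ?IHn; last by rewrite JE ltnn.
by rewrite exprS EFinM.
Qed.

Lemma cdf_event_le j x : P (X j @^-1` `]-oo, x]) = (F x)%:E.
Proof. exact: X_cdf. Qed.

Lemma cdf_event_gt j x : P (X j @^-1` `]x, +oo[) = (1 - F x)%:E.
Proof.
have := ccdf_1_cdf (X j) x; rewrite X_cdf -EFinB => <-.
by [].
Qed.

Lemma iid_same_law j (A : set R) : measurable A -> P (X j @^-1` A) = law P (mX 0%N) A.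
Proof.
move=> mA; rewrite -[LHS]/(law P (mX j) A); apply: probability_eq_cdf => // x.
by rewrite -[LHS]/(P (X j @^-1` `]-oo, x])) -[RHS]/(P (X 0%N @^-1` `]-oo, x])) !cdf_event_le.
Qed.

Hypothesis X_ge0 : forall j w, 0 <= X j w.

Lemma measurable_sample_max v : measurable_fun setT (sample_max X v).
Proof.
rewrite /sample_max; elim: (index_enum _) => [|j s IHs].
  by under eq_fun do rewrite big_nil; exact: mX.
by under eq_fun do rewrite big_cons; exact: (measurable_maxr (mX j) IHs).
Qed.

Lemma measurable_sample_min v : measurable_fun setT (sample_min X v).
Proof.
rewrite /sample_min; elim: (index_enum _) => [|j s IHs].
  by under eq_fun do rewrite big_nil; exact: mX.
by under eq_fun do rewrite big_cons; exact: (measurable_minr (mX j) IHs).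
Qed.

(** The mean of a nonnegative variable is the integral of its tail; the maximum has tail 1 - F^v,
    the minimum (1 - F)^v. *)
Lemma DmaxminE v : (0 < v)%N ->
  Dmaxmin X v = \int[lebesgue_measure]_x ((0 <= x)%R%:R * (1 - weightK v (F x))).
Proof.
move=> v0.
pose M : {RV P >-> R} := HB.pack (sample_max X v)
  (@isMeasurableFun.Build _ _ _ _ (sample_max X v) (measurable_sample_max v)).
pose m : {RV P >-> R} := HB.pack (sample_min X v)
  (@isMeasurableFun.Build _ _ _ _ (sample_min X v) (measurable_sample_min v)).
have M0 w : 0 <= M w.
  by rewrite /M/= /sample_max; elim/big_ind: _ => // x y x0 y0; rewrite le_max x0.
have m0 w : 0 <= m w.
  by rewrite /m/= /sample_min; elim/big_ind: _ => // x y x0 y0; rewrite le_min x0.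
have ccdfM x : ccdf M x = (1 - F x ^+ v)%:E.
  rewrite ccdf_1_cdf EFinB; congr (_ - _)%E.
  rewrite -(@iid_event_prob v `]-oo, x]%classic)//; last by move=> j; exact: cdf_event_le.
  congr (P _); apply/seteqP; split => w; rewrite /= in_itv/= /sample_max.
    by move=> /bigmax_leP[_ h] j jv; rewrite in_itv/=; exact: (h (Ordinal jv)).
  (* The default [X 0] of the big maximum is one of its terms because 0 < v. *)
  move=> h; apply/bigmax_leP; split; first by have := h _ v0; rewrite in_itv.
  by move=> j _; have := h _ (ltn_ord j); rewrite in_itv.
have ccdfm x : ccdf m x = ((1 - F x) ^+ v)%:E.
  rewrite -(@iid_event_prob v `]x, +oo[%classic)//; last by move=> j; exact: cdf_event_gt.
  congr (P _); apply/seteqP; split => w; rewrite /= in_itv/= andbT /sample_min.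
    by move=> /bigmin_gtP[_ h] j jv; rewrite in_itv/= andbT; exact: (h (Ordinal jv)).
  move=> h; apply/bigmin_gtP; split; first by have := h _ v0; rewrite in_itv/= andbT.
  by move=> j _; have := h _ (ltn_ord j); rewrite in_itv/= andbT.
rewrite /Dmaxmin unlock; congr fine.
transitivity ('E_P[M] + 'E_P[m])%E.
  rewrite unlock -ge0_integralD//=.
  - by move=> w _; rewrite lee_fin; exact: M0.
  - exact/measurable_EFinP/measurable_sample_max.
  - by move=> w _; rewrite lee_fin; exact: m0.
  - exact/measurable_EFinP/measurable_sample_min.
rewrite !ge0_expectation_ccdf// -ge0_integralD//; last 2 first.
- by apply: measurable_funTS; exact: ccdf_measurable.
- by apply: measurable_funTS; exact: ccdf_measurable.
rewrite integral_mkcond; apply: eq_integral => x _; rewrite patchE ccdfM ccdfm.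
rewrite mem_setE in_itv/= andbT; case: ifPn => _; rewrite ?mul0r// mul1r -EFinD; congr EFin.
by rewrite /weightK; ring.
Qed.

End iid_sample.

Section linearization.
Context d (T : measurableType d) (R : realType) (P : probability T R).
Variables (F : R -> R) (v : nat) (X : nat -> {RV P >-> R}).
Hypothesis X_iid : iid_with_cdf F X.
Hypothesis X_ge0 : forall j w, 0 <= X j w.
Hypothesis v_gt0 : (0 < v)%N.
Local Notation mu := (@lebesgue_measure R).
Hypothesis tailF : mu.-integrable setT (EFin \o (fun x => (0 <= x)%R%:R * (1 - F x))).

Let half (x : R) : R := (0 <= x)%R%:R.
Let ecdf n x w : R := (sample_count X n x w)%:R / n%:R.
Let mX j : measurable_fun setT (X j). Proof. exact: measurable_funP. Qed.
Let nu := law P (mX 0%N).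

Let nuF x : nu `]-oo, x]%classic = (F x)%:E.
Proof. exact: (cdf_event_le X_iid). Qed.

Let F01 x : 0 <= F x <= 1 := cdf_itv01 nuF x.

Let mF : measurable_fun setT F := measurable_cdf nuF.

Let measurable_half : measurable_fun setT half.
Proof. by apply: measurable_natr_bool; exact: measurable_fun_ler. Qed.

(** At most i observations are <= x exactly when the order statistic of rank i + 1 exceeds x. *)
Let order_kernelE n i w : (i < n)%N ->
  (fun x : R => half x * (sample_count X n x w <= i)%N%:R) =
  \1_`[0, order_stat X n i.+1 w[.
Proof.
move=> iltn; apply/funext => x.
rewrite /half -natrM mulnb indicE mem_setE in_itv/=; congr (nat_of_bool (_ && _))%:R.
by rewrite leqNgt -order_stat_le// -ltNge.
Qed.

Let integrable_order_kernel n (i : 'I_n) w :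
  mu.-integrable setT (EFin \o (fun x => half x * (sample_count X n x w <= i)%N%:R)).
Proof.
rewrite order_kernelE//; apply/integrableP; split.
  by apply/measurable_EFinP; exact: measurable_indic.
under eq_integral do rewrite /= ger0_norm//.
rewrite integral_indic// setIT [ltLHS]lebesgue_measure_itv/=; case: ifPn => _; rewrite ?ltry//.
Qed.

Let order_stat_integral n i w : (i < n)%N ->
  order_stat X n i.+1 w = \int[mu]_x (half x * (sample_count X n x w <= i)%N%:R).
Proof.
move=> iltn; rewrite order_kernelE// /Rintegral integral_indic// setIT.
rewrite [X in fine X]lebesgue_measure_itv/= lte_fin.
have := order_stat_ge0 n i.+1 w X_ge0.
by rewrite le_eqVlt => /orP[/eqP <-|->]; rewrite ?ltxx// -EFinB/= subr0.
Qed.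

Let Dhat_kernel n w x : half x * (\sum_(sample_count X n x w <= i < n) weightD v n i.+1) =
  \sum_(i < n) weightD v n i.+1 * (half x * (sample_count X n x w <= i)%N%:R).
Proof.
rewrite big_geq_mkord big_mkcond/= mulr_sumr; apply: eq_bigr => i _.
by rewrite mulrCA; case: leqP => _; rewrite ?mulr1 ?mulr0.
Qed.

Let Dhat_integral n w : Dhat X v n w =
  \int[mu]_x (half x * \sum_(sample_count X n x w <= i < n) weightD v n i.+1).
Proof.
under eq_Rintegral do rewrite Dhat_kernel.
rewrite (@Rintegral_sum _ _ _ mu _ (fun (i : 'I_n) x =>
  weightD v n i.+1 * (half x * (sample_count X n x w <= i)%N%:R))); last first.
  by move=> i; exact: integrable_funZl.
rewrite /Dhat big_add1 big_mkord mulr_sumr; apply: eq_bigr => i _.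
by rewrite RintegralZl// -order_stat_integral// mulrA.
Qed.

Let integrable_Dhat_kernel n w : mu.-integrable setT
  (EFin \o (fun x => half x * (\sum_(sample_count X n x w <= i < n) weightD v n i.+1))).
Proof.
under eq_fun do rewrite Dhat_kernel.
by apply: integrable_fun_sum => i; exact: integrable_funZl.
Qed.

Let integrable_mean_kernel : mu.-integrable setT
  (EFin \o (fun x => half x * (1 - weightK v (F x)))).
Proof.
have := integrable_funZl measurableT (v%:R + 1) tailF.
apply: le_integrable_fun => //.
  apply: measurable_funM => //; apply: measurable_funB => //.
  by apply: measurable_funB; apply: measurable_funX => //; exact: measurable_funB.
move=> x _; have /andP[k0 k1] := weightK_bound v_gt0 (F01 x).
by rewrite ger0_norm ?mulr_ge0// [leRHS]mulrCA ler_wpM2l.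
Qed.

Let average_centered n x w : (0 < n)%N ->
  n%:R^-1 * \sum_(j < n) (F x - (X j w <= x)%R%:R) = F x - ecdf n x w.
Proof.
move=> n0; have n0' : n%:R != 0 :> R by rewrite pnatr_eq0 -lt0n.
rewrite sumrB sumr_const card_ord -sample_countE mulrBr.
by rewrite -[F x *+ n]mulr_natl mulKf// [n%:R^-1 * _]mulrC.
Qed.

Let influence_average n w : (0 < n)%N ->
  n%:R^-1 * \sum_(j < n) influence F v (X j w) =
  \int[mu]_x (half x * (v%:R * weightJ v (F x)) * (F x - ecdf n x w)).
Proof.
move=> n0; have n0' : n%:R != 0 :> R by rewrite pnatr_eq0 -lt0n.
have ia y := integrable_influence_kernel v nuF tailF y.
rewrite -(@Rintegral_sum _ _ _ mu _ (fun (j : 'I_n) x => influence_kernel F v (X j w) x))//.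
rewrite -RintegralZl//; last exact: integrable_fun_sum.
apply: eq_Rintegral => x _; rewrite /influence_kernel -mulr_sumr mulrCA; congr (_ * _).
by rewrite average_centered.
Qed.

Let integrable_average n w : (0 < n)%N -> mu.-integrable setT
  (EFin \o (fun x => half x * (v%:R * weightJ v (F x)) * (F x - ecdf n x w))).
Proof.
move=> n0; have n0' : n%:R != 0 :> R by rewrite pnatr_eq0 -lt0n.
have ia y := integrable_influence_kernel v nuF tailF y.
have := integrable_funZl measurableT n%:R^-1
  (integrable_fun_sum (fun j : 'I_n => ia (X j w)) (index_enum _)).
rewrite (_ : (fun x => _ * _) = (fun x => half x * (v%:R * weightJ v (F x)) * (F x - ecdf n x w)))//.
apply/funext => x; rewrite /influence_kernel -mulr_sumr mulrCA; congr (_ * _).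
by rewrite average_centered.
Qed.

(** The bound of [weight_error] with k/n the empirical distribution function at x, cut to the
    half-line. *)
Let remainder n x w : R := half x * (2 * v%:R ^+ 2 / n%:R * (1 - ecdf n x w) +
  2 * v%:R ^+ 2 * (ecdf n x w - F x) ^+ 2).

Let ecdf01 n x w : 0 <= ecdf n x w <= 1.
Proof. exact/frac_itv01/sample_count_le. Qed.

Let remainder_ge0 n x w : 0 <= remainder n x w.
Proof.
have /andP[e0 e1] := ecdf01 n x w.
by rewrite mulr_ge0// addr_ge0// mulr_ge0 ?sqr_ge0// ?subr_ge0// divr_ge0// mulr_ge0.
Qed.

Let measurable_remainder n : measurable_fun setT (fun p : T * R => remainder n p.2 p.1).
Proof.
have mF2 := measurableT_comp mF (@measurable_snd _ _ T R).
have me : measurable_fun setT (fun p : T * R => ecdf n p.2 p.1).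
  apply: measurable_funM => //; under eq_fun do rewrite sample_countE.
  apply: measurable_sum => j; apply: measurable_natr_bool.
  by apply: measurable_fun_ler => //; exact: (measurableT_comp (mX j) measurable_fst).
apply: measurable_funM; first exact: (measurableT_comp measurable_half measurable_snd).
apply: measurable_funD; apply: measurable_funM => //; first exact: measurable_funB.
by apply: measurable_funX; exact: measurable_funB.
Qed.

Let measurable_remainder1 n w : measurable_fun setT (fun x => remainder n x w).
Proof. exact: (measurableT_comp (@measurable_remainder n) (pair1_measurable w)). Qed.

(** Among the n indicators of [sample_count <= i] for i < n, exactly n minus the count equal 1, so 1
    - F_n is their average; each is integrable. *)
Let integrable_ecdf_tail n w : (0 < n)%N ->
  mu.-integrable setT (EFin \o (fun x => half x * (1 - ecdf n x w))).
Proof.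
move=> n0; have n0' : n%:R != 0 :> R by rewrite pnatr_eq0 -lt0n.
have := integrable_fun_sum (fun i : 'I_n => @integrable_order_kernel n i w) (index_enum _).
move=> /(integrable_funZl measurableT n%:R^-1).
rewrite (_ : (fun x => _ * _) = (fun x => half x * (1 - ecdf n x w)))//.
apply/funext => x; rewrite -mulr_sumr mulrCA; congr (_ * _).
have cn := sample_count_le X n x w.
rewrite -(big_mkord xpredT (fun i => (sample_count X n x w <= i)%N%:R))/=.
rewrite (big_cat_nat _ (n := sample_count X n x w))//= big_nat big1 ?add0r; last first.
  by move=> i /andP[_ ic]; rewrite leqNgt ic.
rewrite (@eq_big_nat _ _ _ _ _ _ (fun=> 1)); last by move=> i /andP[-> _].
by rewrite sumr_const_nat natrB// mulrBr mulVf// /ecdf mulrC.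
Qed.

Let integrable_remainder n w : (0 < n)%N ->
  mu.-integrable setT (EFin \o (fun x => remainder n x w)).
Proof.
move=> n0; have i1 := integrable_ecdf_tail w n0.
have := integrable_funD measurableT (integrable_funZl measurableT (2 * v%:R ^+ 2 / n%:R + 2 * v%:R ^+ 2) i1)
  (integrable_funZl measurableT (2 * v%:R ^+ 2) tailF).
apply: le_integrable_fun => //; first exact: measurable_remainder1.
move=> x _; rewrite ger0_norm//.
have /andP[e0 e1] := ecdf01 n x w; have /andP[f0 f1] := F01 x.
rewrite /remainder [leRHS](_ : _ = half x * (2 * v%:R ^+ 2 / n%:R * (1 - ecdf n x w) +
  2 * v%:R ^+ 2 * (1 - ecdf n x w + (1 - F x)))); last by rewrite /half; ring.
rewrite ler_wpM2l// lerD2l ler_wpM2l//.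
(* On [0, 1], (a - b)^2 <= |a - b| <= (1 - a) + (1 - b). *)
by move: (ecdf n x w) (F x) e0 e1 f0 f1 => a b *; nra.
Qed.

Let linearization_error n w : (0 < n)%N ->
  `|Dhat X v n w - Dmaxmin X v - n%:R^-1 * \sum_(j < n) influence F v (X j w)| <=
  \int[mu]_x remainder n x w.
Proof.
move=> n0; rewrite (DmaxminE X_iid X_ge0 v_gt0) Dhat_integral influence_average//.
have i1 := integrable_funB measurableT (integrable_Dhat_kernel n w) integrable_mean_kernel.
have i2 := integrable_funB measurableT i1 (integrable_average w n0).
rewrite -RintegralB// -RintegralB//; last exact: integrable_average.
apply: (le_trans (le_normr_Rintegral _ i2)) => //.
apply: le_Rintegral => //.
- exact: integrable_fun_norm.
- exact: integrable_remainder.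
move=> x _; have := weight_error v_gt0 n0 (sample_count_le X n x w) (F01 x).
rewrite -/(ecdf n x w) => h.
rewrite [X in `|X|](_ : _ = half x * (\sum_(sample_count X n x w <= i < n) weightD v n i.+1 -
  (1 - weightK v (F x)) + v%:R * weightJ v (F x) * (ecdf n x w - F x))); last by ring.
by rewrite normrM ger0_norm// ler_wpM2l.
Qed.

Let ind j x w : R := (X j w <= x)%R%:R.

Let measurable_indX j x : measurable_fun setT (ind j x).
Proof. by apply: measurable_natr_bool; exact: measurable_fun_ler. Qed.

Let indXE j x w : ind j x w = \1_(X j @^-1` `]-oo, x]) w.
Proof. by rewrite indicE; congr (nat_of_bool _)%:R; apply/idP/idP; rewrite inE/= in_itv. Qed.

Let measurable_le j x : measurable (X j @^-1` `]-oo, x]).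
Proof. by rewrite -[Y in measurable Y]setTI; exact: mX. Qed.

Let integral_ind j x : \int[P]_w ind j x w = F x.
Proof.
under eq_Rintegral do rewrite indXE.
rewrite /Rintegral integral_indic// setIT.
exact: (congr1 fine (cdf_event_le X_iid j x)).
Qed.

Let integral_ind2 i j x : i != j -> \int[P]_w (ind i x w * ind j x w) = F x ^+ 2.
Proof.
move=> ij; under eq_Rintegral do rewrite !indXE -[_ * _]/((\1__ \* \1__) _) -indicI.
rewrite /Rintegral integral_indic ?setIT//; last exact: measurableI.
have [+ _] := X_iid => /(_ [fset i; j]%fset (fun=> `]-oo, x]%classic) (fun=> measurable_itv _)).
rewrite big_fsetU1/= ?inE// big_seq_fset1 !(cdf_event_le X_iid) -EFinM -expr2.
move=> e; rewrite (_ : _ `&` _ = \bigcap_(k in [set` [fset i; j]%fset]) X k @^-1` `]-oo, x]) ?e//.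
apply/seteqP; split => w /=.
  by move=> [wi wj] k /=; rewrite !inE => /orP[] /eqP ->.
by move=> h; split; apply: (h _); rewrite /= !inE eqxx ?orbT.
Qed.

Let ind_le1 j x w : 0 <= ind j x w <= 1.
Proof. by rewrite ler0n lern1 leq_b1. Qed.

Let integrable_centered2 i j x :
  P.-integrable setT (EFin \o (fun w => (ind i x w - F x) * (ind j x w - F x))).
Proof.
apply: (@integrable_le_cst _ _ _ _ _ 1).
  by apply: measurable_funM; exact: measurable_funB.
move=> w; have /andP[f0 f1] := F01 x.
have /andP[? ?] := ind_le1 i x w; have /andP[? ?] := ind_le1 j x w.
rewrite normrM; apply: mulr_ile1 => //; rewrite ler_norml; apply/andP; split; lra.
Qed.

Let integral_centered2 i j x :
  \int[P]_w ((ind i x w - F x) * (ind j x w - F x)) = (i == j)%:R * (F x * (1 - F x)).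
Proof.
have i1 k : P.-integrable setT (EFin \o ind k x).
  apply: (@integrable_le_cst _ _ _ _ _ 1) => // w.
  by have /andP[? ?] := ind_le1 k x w; rewrite ger0_norm.
have i2 : P.-integrable setT (EFin \o (fun w => ind i x w * ind j x w)).
  apply: (@integrable_le_cst _ _ _ _ _ 1) => [|w]; first exact: measurable_funM.
  have /andP[? ?] := ind_le1 i x w; have /andP[? ?] := ind_le1 j x w.
  by rewrite ger0_norm ?mulr_ge0// mulr_ile1.
have i3 : P.-integrable setT (EFin \o cst (F x ^+ 2)) by exact: finite_measure_integrable_cst.
transitivity (\int[P]_w (ind i x w * ind j x w - F x * ind i x w - F x * ind j x w + F x ^+ 2)).
  by apply: eq_Rintegral => w _; ring.
have i12 := integrable_funB measurableT i2 (integrable_funZl measurableT (F x) (i1 i)).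
have i123 := integrable_funB measurableT i12 (integrable_funZl measurableT (F x) (i1 j)).
rewrite RintegralD// Rintegral_prob_cst RintegralB//; last exact: integrable_funZl.
rewrite RintegralB//; last exact: integrable_funZl.
rewrite !RintegralZl// !integral_ind; case: eqVneq => [<-|ij].
  have -> : \int[P]_w (ind i x w * ind i x w) = F x.
    rewrite -(integral_ind i); apply: eq_Rintegral => w _.
    by rewrite /ind -natrM mulnb andbb.
  by rewrite -[true%:R]/(1 : R); ring.
by rewrite integral_ind2// -[false%:R]/(0 : R); ring.
Qed.

(** Expanding the square as a double sum, only the n diagonal terms survive, by pairwise
    independence. *)
Let ecdf_variance n x : (0 < n)%N ->
  \int[P]_w ((ecdf n x w - F x) ^+ 2) = F x * (1 - F x) / n%:R.
Proof.
move=> n0; have n0' : n%:R != 0 :> R by rewrite pnatr_eq0 -lt0n.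
transitivity (\int[P]_w (n%:R^-1 ^+ 2 *
    \sum_(i < n) \sum_(j < n) (ind i x w - F x) * (ind j x w - F x))).
  apply: eq_Rintegral => w _; under eq_bigr do rewrite -mulr_sumr.
  rewrite -mulr_suml -expr2 -exprMn -[LHS]sqrrN opprB -average_centered// -[RHS]sqrrN -mulrN -sumrN.
  by under [in RHS]eq_bigr do rewrite opprB.
have i1 (i : 'I_n) := integrable_fun_sum (fun j : 'I_n => integrable_centered2 i j x) (index_enum _).
rewrite RintegralZl//; last exact: integrable_fun_sum.
rewrite (Rintegral_sum i1).
under eq_bigr => i _.
  rewrite (Rintegral_sum (fun j : 'I_n => integrable_centered2 i j x)).
  under eq_bigr do rewrite integral_centered2 mulr_natl mulrb.
  rewrite -big_mkcond/= (bigD1 i)//= big1 ?addr0; last first.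
    by move=> j /andP[/eqP/val_inj ->]; rewrite eqxx.
  over.
by rewrite sumr_const card_ord -mulr_natl; field.
Qed.

(** Both parts of the remainder have mean at most 2 v^2 (1 - F) / n: the first because F_n has mean
    F, the second because its variance is F (1 - F) / n. *)
Let expected_remainder n : (0 < n)%N ->
  (\int[P]_w (\int[mu]_x remainder n x w)%:E <=
   (4 * v%:R ^+ 2 / n%:R * \int[mu]_x (half x * (1 - F x)))%:E)%E.
Proof.
move=> n0; have n0' : n%:R != 0 :> R by rewrite pnatr_eq0 -lt0n.
under eq_integral do rewrite (integrable_Rintegral_EFin measurableT (integrable_remainder _ n0)).
have /= -> := @fubini_tonelli _ _ _ _ _ P mu (fun p => (remainder n p.2 p.1)%:E) _ _; last 2 first.
- by apply/measurable_EFinP; exact: measurable_remainder.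
- by move=> p; rewrite lee_fin.
rewrite -RintegralZl// integrable_Rintegral_EFin//; last exact: integrable_funZl.
have Ie x : P.-integrable setT (EFin \o ecdf n x).
  apply: (@integrable_le_cst _ _ _ _ _ 1) => [|w].
    apply: measurable_funM => //; under eq_fun do rewrite sample_countE.
    by apply: measurable_sum => j; exact: measurable_indX.
  by have /andP[? ?] := ecdf01 n x w; rewrite ger0_norm.
have Ee x : \int[P]_w ecdf n x w = F x.
  rewrite /ecdf; under eq_Rintegral do rewrite sample_countE mulr_suml.
  have i1 j : P.-integrable setT (EFin \o (fun w => ind j x w / n%:R)).
    apply: integrable_funZr => //; apply: (@integrable_le_cst _ _ _ _ _ 1) => // w.
    by have /andP[? ?] := ind_le1 j x w; rewrite ger0_norm.
  rewrite (Rintegral_sum (fun j : 'I_n => i1 j)).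
  under eq_bigr => j _.
    rewrite RintegralZr//; last first.
      apply: (@integrable_le_cst _ _ _ _ _ 1) => // w.
      by have /andP[? ?] := ind_le1 j x w; rewrite ger0_norm.
    rewrite integral_ind; over.
  by rewrite sumr_const card_ord -mulr_natl; field.
have Iv x : P.-integrable setT (EFin \o (fun w => (ecdf n x w - F x) ^+ 2)).
  apply: (@integrable_le_cst _ _ _ _ _ 1) => [|w].
    apply: measurable_funX; apply: measurable_funB => //.
    by have /integrableP[/measurable_EFinP] := Ie x.
  have /andP[? ?] := ecdf01 n x w; have /andP[? ?] := F01 x.
  rewrite ger0_norm ?sqr_ge0// -[leLHS]real_normK ?num_real// expr_le1// ler_norml.
  by apply/andP; split; lra.
have i0 : P.-integrable setT (EFin \o cst (1 : R)) by exact: finite_measure_integrable_cst.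
have I1 x : P.-integrable setT (EFin \o (fun w => 1 - ecdf n x w)).
  exact (integrable_funB measurableT i0 (Ie x)).
have E1 x : (\int[P]_w (remainder n x w)%:E =
    (half x * (2 * v%:R ^+ 2 / n%:R * (1 - F x) + 2 * v%:R ^+ 2 * (F x * (1 - F x) / n%:R)))%:E)%E.
  rewrite -integrable_Rintegral_EFin//; last first.
    by apply: integrable_funZl => //; apply: integrable_funD => //; exact: integrable_funZl.
  rewrite RintegralZl//; last by apply: integrable_funD => //; exact: integrable_funZl.
  rewrite RintegralD//; [|exact: integrable_funZl..].
  rewrite !RintegralZl// ecdf_variance// RintegralB//.
  by rewrite Rintegral_prob_cst Ee.
apply: ge0_le_integral => //.
- by move=> x _; apply: integral_ge0 => w _; rewrite lee_fin.
- under eq_fun do rewrite E1.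
  apply/measurable_EFinP; apply: measurable_funM => //.
  apply: measurable_funD; apply: measurable_funM => //; first exact: measurable_funB.
  by apply: measurable_funM => //; apply: measurable_funM => //; exact: measurable_funB.
- apply/measurable_EFinP; apply: measurable_funM => //.
  by apply: measurable_funM => //; exact: measurable_funB.
move=> x _; rewrite E1 lee_fin [leRHS]mulrCA ler_wpM2l//.
have /andP[f0 f1] := F01 x.
rewrite -subr_ge0 (_ : _ - _ = 2 * v%:R ^+ 2 / n%:R * (1 - F x) ^+ 2); last by field.
by rewrite mulr_ge0 ?sqr_ge0// divr_ge0// mulr_ge0.
Qed.

Lemma linearization_L1 n : (0 < n)%N ->
  (\int[P]_w `|Dhat X v n w - Dmaxmin X v - n%:R^-1 * \sum_(j < n) influence F v (X j w)|%:E <=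
   (4 * v%:R ^+ 2 / n%:R * \int[mu]_x ((0 <= x)%R%:R * (1 - F x)))%:E)%E.
Proof.
move=> n0; apply: le_trans (expected_remainder n0); apply: ge0_le_integral => //.
- apply/measurable_EFinP; apply: measurableT_comp => //; apply: measurable_funB.
    by apply: measurable_funB => //; exact: measurable_Dhat.
  apply: measurable_funM => //; apply: measurable_sum => j.
  exact: (measurableT_comp (measurable_influence v nuF tailF) (mX j)).
- under eq_fun do rewrite (integrable_Rintegral_EFin measurableT (integrable_remainder _ n0)).
  apply: (@measurable_fun_fubini_tonelli_F _ _ _ _ _ mu (fun p => (remainder n p.2 p.1)%:E)).
    by apply/measurable_EFinP; exact: measurable_remainder.
  by move=> p; rewrite lee_fin.
- by move=> w _; rewrite lee_fin linearization_error.
Qed.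

End linearization.

(** * Limit theorem *)

Section nonnegative_sample.
Context d (T : measurableType d) (R : realType) (P : probability T R).
Variables (F : R -> R) (v : nat) (X : nat -> {RV P >-> R}).
Hypothesis X_iid : iid_with_cdf F X.
Hypothesis X_ge0 : forall j w, 0 <= X j w.
Hypothesis v_gt0 : (0 < v)%N.
Local Notation mu := (@lebesgue_measure R).
Hypothesis tailF : mu.-integrable setT (EFin \o (fun x => (0 <= x)%R%:R * (1 - F x))).
Hypothesis sigma_gt0 : (0 < sigma4sq F v)%E.
Hypothesis sigma_fin : (sigma4sq F v < +oo)%E.

Let mX j : measurable_fun setT (X j). Proof. exact: measurable_funP. Qed.
Let nu := law P (mX 0%N).

Let nuF x : nu `]-oo, x]%classic = (F x)%:E.
Proof. exact: (cdf_event_le X_iid). Qed.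

Let s := sigma4 F v.

Let s_gt0 : 0 < s.
Proof. by rewrite /s /sigma4 sqrtr_gt0 fine_gt0// sigma_gt0. Qed.

Let s_sqr : (s ^+ 2)%:E = sigma4sq F v.
Proof.
rewrite /s /sigma4 sqr_sqrtr; first by rewrite fineK// ge0_fin_numE// ltW.
by rewrite fine_ge0// ltW.
Qed.

Let g y := s^-1 * influence F v y.

Let mg : measurable_fun setT g.
Proof. by apply: measurable_funM => //; exact: (measurable_influence v nuF tailF). Qed.

Let g_moment2 : (\int[nu]_y (g y ^+ 2)%:E = 1)%E.
Proof.
under eq_integral do rewrite /g exprMn EFinM.
rewrite ge0_integralZl//; last 3 first.
- by apply/measurable_EFinP; apply: measurable_funX; exact: (measurable_influence v nuF tailF).
- by move=> y _; rewrite lee_fin sqr_ge0.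
- by rewrite lee_fin sqr_ge0.
by rewrite influence_variance// -s_sqr -EFinM exprVn mulVf// expf_neq0// gt_eqF.
Qed.

Let integrable_g : nu.-integrable setT (EFin \o g).
Proof.
apply: integrable_of_sqr => //; apply/integrableP; split.
  by apply/measurable_EFinP; exact: measurable_funX.
by under eq_integral do rewrite /= ger0_norm ?sqr_ge0//; rewrite g_moment2 ltry.
Qed.

Let g_mean : (\int[nu]_y (g y)%:E = 0)%E.
Proof.
have iI : nu.-integrable setT (EFin \o influence F v).
  have := integrable_funZl measurableT s integrable_g.
  rewrite (_ : (fun x => _) = influence F v)//.
  by apply/funext => y; rewrite /g mulVKf// gt_eqF.
under eq_integral do rewrite EFinM.
by rewrite integralZl// influence_mean// mule0.
Qed.

Let mgX j : measurable_fun setT (fun w => g (X j w)).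
Proof. exact: (measurableT_comp mg (mX j)). Qed.

Let Y j : {RV P >-> R} := HB.pack (fun w => g (X j w))
  (@isMeasurableFun.Build _ _ _ _ (fun w => g (X j w)) (mgX j)).

Let Y_ind : mutually_independent Y.
Proof.
move=> J A mA; have [+ _] := X_iid => /(_ J (fun i => g @^-1` A i)) -> // i.
by rewrite -[B in measurable B]setTI; exact: mg.
Qed.

Let nuY := law P (mgX 0%N).

Let Y_law j (A : set R) : measurable A -> P (Y j @^-1` A) = nuY A.
Proof.
move=> mA; have mgA : measurable (g @^-1` A).
  by rewrite -[B in measurable B]setTI; exact: mg.
exact: (iid_same_law X_iid j mgA).
Qed.

Let Y_moment2 : (\int[nuY]_y (y ^+ 2)%:E = 1)%E.
Proof.
rewrite ge0_integral_law//; last 2 first.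
- by apply/measurable_EFinP; exact: measurable_funX.
- by move=> y; rewrite lee_fin sqr_ge0.
rewrite -g_moment2 (@ge0_integral_law _ _ _ P _ (mX 0%N) (fun y => (g y ^+ 2)%:E))//.
- by apply/measurable_EFinP; exact: measurable_funX.
- by move=> y; rewrite lee_fin sqr_ge0.
Qed.

Let integrable_gX j : P.-integrable setT (EFin \o (fun w => g (X j w))).
Proof.
apply: integrable_of_sqr => //; apply/integrableP; split.
  by apply/measurable_EFinP; exact: measurable_funX.
under eq_integral do rewrite /= ger0_norm ?sqr_ge0//.
rewrite -(@ge0_integral_law _ _ _ P _ (mgX j) (fun y => (y ^+ 2)%:E))//; last 2 first.
- by apply/measurable_EFinP; exact: measurable_funX.
- by move=> y; rewrite lee_fin sqr_ge0.
rewrite (eq_measure_integral nuY); last by move=> A mA _; exact: Y_law.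
by rewrite Y_moment2 ltry.
Qed.

Let Y_mean : (\int[nuY]_y y%:E = 0)%E.
Proof.
rewrite integral_law//; last exact: integrable_gX.
rewrite -g_mean (@integral_law _ _ _ P _ (mX 0%N) (fun y => (g y)%:E))//.
- exact/measurable_EFinP.
- exact: integrable_gX.
Qed.

Let V n w := Num.sqrt n%:R * (Dhat X v n w - Dmaxmin X v) / s.

Let W n w := (Num.sqrt n%:R)^-1 * \sum_(j < n) Y j w.

Let measurable_V n : measurable_fun setT (V n).
Proof.
apply: measurable_funM => //; apply: measurable_funM => //.
by apply: measurable_funB => //; exact: measurable_Dhat.
Qed.

Let measurable_W n : measurable_fun setT (W n).
Proof. by apply: measurable_funM => //; apply: measurable_sum => j; exact: mgX. Qed.

Let VW n w : (0 < n)%N -> V n w - W n w = Num.sqrt n%:R / s *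
  (Dhat X v n w - Dmaxmin X v - n%:R^-1 * \sum_(j < n) influence F v (X j w)).
Proof.
move=> n0; have sn0 : Num.sqrt n%:R != 0 :> R by rewrite gt_eqF// sqrtr_gt0 ltr0n.
have s0 : s != 0 by rewrite gt_eqF.
rewrite /V /W /= /g -mulr_sumr -[in n%:R^-1](@sqr_sqrtr R n%:R)//.
by move: (Num.sqrt n%:R) sn0 (\sum_(j < n) _) => a a0 b; field; rewrite s0 a0.
Qed.

(** A Lipschitz f turns the L1 linearization error, of order 1/n, into a gap of order 1/n times the
    scaling sqrt n. *)
Let smooth_gap C f : bounded_lipschitz C f ->
  exists K, forall n, (0 < n)%N ->
    `|\int[P]_w f (V n w) - \int[P]_w f (W n w)| <= K / Num.sqrt n%:R.
Proof.
move=> fC; have C0 := bounded_lipschitz_ge0 fC; have mf := bounded_lipschitz_measurable fC.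
have mfZ (Z : T -> R) : measurable_fun setT Z -> measurable_fun setT (fun w => f (Z w)).
  by move=> mZ; exact: (measurableT_comp mf mZ).
have ifZ (Z : T -> R) : measurable_fun setT Z -> P.-integrable setT (EFin \o (fun w => f (Z w))).
  by move=> mZ; apply: (@integrable_le_cst _ _ _ _ _ C) => [|w]; [exact: mfZ|exact: fC.1].
pose A := \int[mu]_x ((0 <= x)%R%:R * (1 - F x)).
exists (C / s * (4 * v%:R ^+ 2 * A)) => n n0.
have sn0 : 0 < Num.sqrt n%:R :> R by rewrite sqrtr_gt0 ltr0n.
have iB := integrable_funB measurableT (ifZ _ (measurable_V n)) (ifZ _ (measurable_W n)).
rewrite -RintegralB//; [|exact: ifZ..].
apply: (le_trans (le_normr_Rintegral _ iB)) => //.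
rewrite -lee_fin integrable_Rintegral_EFin//; last exact: integrable_fun_norm.
have L1 := linearization_L1 X_iid X_ge0 v_gt0 tailF n0.
set Delta := fun w => Dhat X v n w - Dmaxmin X v - n%:R^-1 * \sum_(j < n) influence F v (X j w).
have mDelta : measurable_fun setT Delta.
  apply: measurable_funB; first by apply: measurable_funB => //; exact: measurable_Dhat.
  apply: measurable_funM => //; apply: measurable_sum => j.
  exact: (measurableT_comp (measurable_influence v nuF tailF) (mX j)).
have c0 : 0 <= C * (Num.sqrt n%:R / s) by rewrite mulr_ge0// divr_ge0// ltW.
apply: (@le_trans _ _ ((C * (Num.sqrt n%:R / s))%:E * \int[P]_w `|Delta w|%:E)%E).
  rewrite -ge0_integralZl//; last first.
    by apply/measurable_EFinP; exact: measurableT_comp.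
  apply: ge0_le_integral => //.
  - by apply/measurable_EFinP; apply: measurableT_comp => //; apply: measurable_funB; exact: mfZ.
  - apply: emeasurable_funM => //; apply/measurable_EFinP; exact: measurableT_comp.
  move=> w _; rewrite -EFinM lee_fin -[V n w](subrKC (W n w)) (le_trans (fC.2 _ _))//.
  rewrite VW// -/(Delta w) normrM (ger0_norm (_ : 0 <= _ / s)) ?mulrA//.
  by rewrite divr_ge0// ltW.
apply: (le_trans (lee_wpmul2l _ L1)) => //.
rewrite -EFinM lee_fin -/A -[in n%:R^-1](@sqr_sqrtr R n%:R)//.
rewrite le_eqVlt; apply/orP; left; apply/eqP.
have s0 : s != 0 by rewrite gt_eqF.
by move: (Num.sqrt n%:R) sn0 => a /lt0r_neq0 a0; field; rewrite s0 a0.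
Qed.

Lemma Dhat_cvg_in_distribution :
  cvg_in_distribution P
    (fun n w => Num.sqrt n%:R * (Dhat X v n w - Dmaxmin X v) / sigma4 F v) (normal_prob 0 1).
Proof.
split=> [|t tc]; first exact: measurable_V.
apply: (@cvg_cdf_of_smooth _ _ _ P V) => //.
move=> C f f1 f2 fT f01; have [fC _ _ _] := fT.
have [K KP] := smooth_gap fC.
have f0 x : 0 <= f x by have /andP[] := f01 x.
have := @iter_smear_cvg _ C nuY f f1 f2 0 fT f0 Y_moment2 Y_mean.
rewrite {2}/smear; under eq_Rintegral do rewrite add0r mul1r.
apply: cvg_sub0; apply/cvgr0Pnorm_le => e e0; near=> n.
have n0 : (0 < n)%N by near: n; exact: nbhs_infty_gt.
have sn0 : 0 < Num.sqrt n%:R :> R by rewrite sqrtr_gt0 ltr0n.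
rewrite -[X in `|_ - X|](integral_partial_sum Y_ind _ _ Y_law fC) (le_trans (KP n n0))//.
(* The gap is at most e once n >= (K / e)^2; the absolute value covers a K of unknown sign. *)
rewrite ler_pdivrMr// mulrC -ler_pdivrMr//; apply: le_trans (ler_norm _) _.
rewrite -sqrtr_sqr ler_wsqrtr//.
by near: n; exact: nbhs_infty_ger.
Unshelve. all: by end_near. Qed.

End nonnegative_sample.

(** The integral of 1 - F over the half-line is E X. *)
Lemma integrable_cdf_tail d (T : measurableType d) (R : realType) (P : probability T R)
    (X : {RV P >-> R}) (F : R -> R) :
  (forall x, cdf X x = (F x)%:E) -> (forall w, 0 <= X w) -> ('E_P[X] < +oo)%E ->
  lebesgue_measure.-integrable setT (EFin \o (fun x => (0 <= x)%R%:R * (1 - F x))).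
Proof.
move=> X_cdf X0 EX; pose mX : measurable_fun setT X := measurable_funP X.
have nuF x : law P mX `]-oo, x]%classic = (F x)%:E by exact: X_cdf.
have mF := measurable_cdf nuF.
apply/integrableP; split.
  apply/measurable_EFinP; apply: measurable_funM; last exact: measurable_funB.
  by apply: measurable_natr_bool; exact: measurable_fun_ler.
move: EX; rewrite ge0_expectation_ccdf// integral_mkcond.
apply: le_lt_trans.
rewrite le_eqVlt; apply/orP; left; apply/eqP; apply: eq_integral => x _.
rewrite patchE /= mem_setE in_itv/= andbT ccdf_1_cdf X_cdf -EFinB.
have /andP[_ F1] := cdf_itv01 nuF x.
by case: (0 <= x); rewrite ?mul1r ?mul0r ?normr0// ger0_norm// subr_ge0.
Qed.

(** * Passage to an almost surely equal nonnegative sample *)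

Section almost_sure_modification.
Context d (T : measurableType d) (R : realType) (P : probability T R).

Lemma probability_eq_ae (A B N : set T) :
  measurable A -> measurable B -> measurable N -> P N = 0%E ->
  (forall w, ~ N w -> A w <-> B w) -> P A = P B.
Proof.
have le (A' B' : set T) : measurable A' -> measurable B' -> measurable N -> P N = 0%E ->
    (forall w, ~ N w -> A' w -> B' w) -> (P A' <= P B')%E.
  move=> mA mB mN N0 AB; rewrite -[leRHS]adde0 -N0.
  apply: le_trans (measureU2 P mB mN); apply: le_measure; rewrite ?inE//.
    exact: measurableU.
  by move=> w Aw; have [Nw|Nw] := pselect (N w); [right|left; exact: AB].
move=> mA mB mN N0 AB; apply/eqP; rewrite eq_le !le// => w Nw; first by move=> /(AB w Nw).
by move=> /(AB w Nw).
Qed.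

Variables X X' : nat -> {RV P >-> R}.
Variable N : set T.
Hypotheses (mN : measurable N) (N0 : P N = 0%E).
Hypothesis XX' : forall w, ~ N w -> forall j, X j w = X' j w.

Lemma Dmaxmin_eq_ae v : Dmaxmin X v = Dmaxmin X' v.
Proof.
rewrite /Dmaxmin unlock; congr fine; apply: ae_eq_integral => //.
- apply/measurable_EFinP; apply: measurable_funD.
    exact: measurable_sample_max.
  exact: measurable_sample_min.
- apply/measurable_EFinP; apply: measurable_funD.
    exact: measurable_sample_max.
  exact: measurable_sample_min.
exists N; split => // w /= h; apply: contrapT => Nw; apply: h => _.
by rewrite /sample_max /sample_min; congr (_ + _)%:E; rewrite (XX' Nw);
  apply: eq_bigr => j _; exact: XX'.
Qed.

Lemma Dhat_eq_ae v n w : ~ N w -> Dhat X v n w = Dhat X' v n w.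
Proof.
move=> Nw; rewrite /Dhat /order_stat.
by rewrite (_ : [seq X j w | j <- iota 0 n] = [seq X' j w | j <- iota 0 n])//;
  apply: eq_map => j; exact: XX'.
Qed.

(** The two centerings coincide and the events differ only inside the null set [N], so the
    probabilities are equal for each n. *)
Lemma cvg_Dhat_eq_ae v (a : nat -> R) (b : R) mu :
  cvg_in_distribution P (fun n w => a n * (Dhat X' v n w - Dmaxmin X' v) / b) mu ->
  cvg_in_distribution P (fun n w => a n * (Dhat X v n w - Dmaxmin X v) / b) mu.
Proof.
have mV (Z : nat -> {RV P >-> R}) n :
    measurable_fun setT (fun w => a n * (Dhat Z v n w - Dmaxmin Z v) / b).
  apply: measurable_funM => //; apply: measurable_funM => //.
  by apply: measurable_funB => //; exact: measurable_Dhat.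
have mle (Z : nat -> {RV P >-> R}) n t :
    measurable [set w | a n * (Dhat Z v n w - Dmaxmin Z v) / b <= t].
  rewrite -[Y in measurable Y]setTI.
  exact: (measurable_fun_le measurableT (mV Z n) (measurable_cst _)).
case=> _ h; split => // t /h.
rewrite (_ : (fun n => P _) = (fun n => P [set w | a n * (Dhat X v n w - Dmaxmin X v) / b <= t]))//.
apply/funext => n; apply: (probability_eq_ae (N := N)) => // w Nw /=.
by rewrite (Dhat_eq_ae _ _ Nw) Dmaxmin_eq_ae.
Qed.

End almost_sure_modification.

Section nonnegative_version.
Context d (T : measurableType d) (R : realType) (P : probability T R).
Variables (F : R -> R) (X : {RV P >-> R}) (Xs : nat -> {RV P >-> R}).
Hypothesis X_cdf : forall x, cdf X x = (F x)%:E.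
Hypothesis X_ge0 : forall w, 0 <= X w.
Hypothesis Xs_iid : iid_with_cdf F Xs.

Let mX : measurable_fun setT X. Proof. exact: measurable_funP. Qed.
Let mXs j : measurable_fun setT (Xs j). Proof. exact: measurable_funP. Qed.

Let mpos : measurable_fun setT (fun x : R => Num.max x 0).
Proof. exact: measurable_maxr. Qed.

Let mXp j : measurable_fun setT (fun w => Num.max (Xs j w) 0).
Proof. exact: (measurableT_comp mpos (mXs j)). Qed.

Let Xp j : {RV P >-> R} := HB.pack (fun w => Num.max (Xs j w) 0)
  (@isMeasurableFun.Build _ _ _ _ (fun w => Num.max (Xs j w) 0) (mXp j)).

(** [Xs j] has the same law as [X], which is nowhere negative. *)
Let negative_null j : P (Xs j @^-1` `]-oo, 0[) = 0%E.
Proof.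
rewrite -[LHS]/(law P (mXs j) `]-oo, 0[%classic) (@probability_eq_cdf _ _ (law P mX))//.
  rewrite -[LHS]/(P (X @^-1` `]-oo, 0[)) (_ : _ @^-1` _ = set0) ?measure0//.
  by apply/seteqP; split => // w /=; rewrite in_itv/= ltNge X_ge0.
by move=> x; rewrite -[LHS]/(cdf (Xs j) x) -[RHS]/(cdf X x) X_cdf; case: Xs_iid => _ ->.
Qed.

Lemma nonnegative_version : exists Xp : nat -> {RV P >-> R},
  [/\ iid_with_cdf F Xp, forall j w, 0 <= Xp j w &
   exists N, [/\ measurable N, P N = 0%E & forall w, ~ N w -> forall j, Xs j w = Xp j w]].
Proof.
have [ind Xs_cdf] := Xs_iid.
exists Xp; split; last 2 first.
- by move=> j w; rewrite le_max lexx orbT.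
- have mNj j : measurable (Xs j @^-1` `]-oo, 0[).
    by rewrite -[Y in measurable Y]setTI; exact: mXs.
  exists (\bigcup_j Xs j @^-1` `]-oo, 0[); split.
  + exact: bigcup_measurable.
  + apply/negligibleP; first exact: bigcup_measurable.
    by apply: negligible_bigcup => j; exists (Xs j @^-1` `]-oo, 0[); split => //; exact: negative_null.
  + move=> w Nw j; rewrite /= max_l// leNgt; apply/negP => neg; apply: Nw.
    by exists j => //=; rewrite in_itv.
split.
  move=> J A mA; have := ind J (fun i => (fun x => Num.max x 0) @^-1` A i); apply => i.
  by rewrite -[Y in measurable Y]setTI; exact: mpos.
move=> j x; have [x0|x0] := leP 0 x.
  rewrite -(Xs_cdf j) /cdf; congr (P _); apply/seteqP; split => w /=; rewrite !in_itv/= ge_max x0 andbT//.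
(* For x < 0 both distribution functions vanish, since [X] and the positive part are nonnegative
   everywhere. *)
rewrite -X_cdf /cdf; transitivity (P set0); last first.
  congr (P _); apply/seteqP; split => // w /=; rewrite in_itv/= => Xx.
  by have := X_ge0 w; rewrite leNgt (le_lt_trans Xx).
congr (P _); apply/seteqP; split => // w /=; rewrite in_itv/= ge_max => /andP[_].
by rewrite leNgt x0.
Qed.

End nonnegative_version.

Theorem corollary4 (R : realType) (d : measure_display) (T : measurableType d)
    (P : probability T R) (v : nat) (F : R -> R)
    (X : {RV P >-> R}) (Xs : nat -> {RV P >-> R}) :
  (1 < v)%N ->
  absolutely_continuous_fun F ->
  (forall x, cdf X x = (F x)%:E) ->
  (forall w, 0 <= X w) ->
  ('E_P[X] < +oo)%E ->
  iid_with_cdf F Xs ->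
  (0 < sigma4sq F v)%E ->
  (sigma4sq F v < +oo)%E ->
  cvg_in_distribution P
    (fun n w => Num.sqrt n%:R * (Dhat Xs v n w - Dmaxmin Xs v) / sigma4 F v)
    (normal_prob 0 1).
Proof.
move=> v1 _ X_cdf X0 EX Xs_iid s0 soo.
have tailF := integrable_cdf_tail X_cdf X0 EX.
have [Xp [Xp_iid Xp0 [N [mN N0 XN]]]] := nonnegative_version X_cdf X0 Xs_iid.
apply: (cvg_Dhat_eq_ae mN N0 XN).
exact: (Dhat_cvg_in_distribution Xp_iid Xp0 (ltnW v1) tailF s0 soo).
Qed.
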